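(* Let the pair $\{E,F\}$ (equivalently, the DAE $E(t)x'(t)+F(t)x(t)=q(t)$) be regular on $\mathcal I$ with index $\mu$ and characteristic values $r,\theta_0\ge\dots\ge\theta_{\mu-2}>\theta_{\mu-1}=0$. Then: (1) for every $t\in\mathcal I$ the flow-subspace $S_{can}(t)$ has dimension $d=r-\sum_{i=0}^{\mu-2}\theta_i=r_{\mu-1}$, and the matrix function $C=C_0C_1\cdots C_{\mu-2}:\mathcal I\to\mathbb R^{m\times d}$ generated by the reduction procedure has columns forming a basis of $S_{can}(t)$ for every $t\in\mathcal I$; (2) for every subinterval $\mathcal I_{sub}\subset\mathcal I$, the restriction of the pair to $\mathcal I_{sub}$ is regular with the same index $\mu$ and the same characteristic values.
   Context: Let $\mathcal I\subseteq\mathbb R$ be an interval and $E,F:\mathcal I\to\mathbb R^{m\times m}$ sufficiently smooth (of class $C^m$). For a pair $\{E,F\}$ put $S(t)=\{z\in\mathbb R^m: F(t)z\in\operatorname{im}E(t)\}$. The pair is called pre-regular on $\mathcal I$ if $\operatorname{im}[E(t)\ F(t)]=\mathbb R^m$, $\operatorname{rank}E(t)=r$ and $\dim(S(t)\cap\ker E(t))=\theta$ for all $t\in\mathcal I$, with constant integers $r,\theta$. Reduction procedure: $E_0=E$, $F_0=F$, $m_0=m$. Given a pre-regular pair $\{E_i,F_i\}$ of size $m_i\times m_i$ with $\operatorname{rank}E_i=r_i$, choose smooth matrix functions $Y_i$ ($m_i\times r_i$) and $Z_i$ ($m_i\times(m_i-r_i)$) whose columns form bases of $\operatorname{im}E_i(t)$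 and $(\operatorname{im}E_i(t))^\perp$, and a smooth $C_i$ ($m_i\times r_i$) whose columns form a basis of $S_i(t)=\ker Z_i(t)^*F_i(t)$; set $E_{i+1}=Y_i^*E_iC_i$, $F_{i+1}=Y_i^*(F_iC_i+E_iC_i')$ (size $r_i\times r_i$), and $\theta_i=\dim(\ker E_i\cap S_i)$; then $r_{i+1}=r_i-\theta_i$. The pair $\{E,F\}$ with $r=\operatorname{rank}E<m$ is called regular with index $\mu\in\mathbb N$ if the procedure is well defined up to level $\mu-1$, each pair $\{E_i,F_i\}$, $i=0,\dots,\mu-1$, is pre-regular, and the constants satisfy $\theta_0\ge\dots\ge\theta_{\mu-2}>\theta_{\mu-1}=0$ (for $\mu=1$: $\theta_0=0$). The values $r,\theta_0,\dots,\theta_{\mu-2}$ are the characteristic values; they do not depend on the choice of bases. The flow-subspace is $S_{can}(\bar t)=\{x(\bar t): x$ is a solution of $Ex'+Fx=0$ on $(\bar t-\delta,\bar t+\delta)\cap\mathcal I$ for some $\delta>0\}$.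
   Formalization: The product C is taken as C_0 C_1 ⋯ C_{μ-1} instead of C_0 ⋯ C_{μ-2}: with C_i of size m_i×r_i the printed product has r_{μ-2} columns rather than d = r_{μ-1} (for μ=1 it would be the identity), so it cannot be a basis of S_can. *)

(* Defs.v *)
From HB Require Import structures.
From mathcomp Require Import all_boot all_order all_algebra.
From mathcomp Require Import all_classical all_reals all_analysis.
Set Implicit Arguments. Unset Strict Implicit. Unset Printing Implicit Defensive.
Import Order.TTheory GRing.Theory Num.Theory.
Import numFieldNormedType.Exports.
Local Open Scope classical_set_scope.
Local Open Scope ring_scope.

Section DAE.
Variable R : realType.

Definition nd_interval (I : set R) : Prop :=
  (exists a b, I a /\ I b /\ a < b) /\
  (forall a b c, I a -> I c -> a <= b -> b <= c -> I b).

(* f' is the derivative of f on I (one-sided at endpoints belonging to I). *)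
Definition has_deriv_on (I : set R) (f f' : R -> R) : Prop :=
  forall t, I t ->
    (fun s => (f s - f t) / (s - t)) @ within [set s | I s /\ s != t] (nbhs t)
      --> f' t.

Fixpoint Ck (k : nat) (I : set R) (f : R -> R) : Prop :=
  if k is k'.+1 then exists f', has_deriv_on I f f' /\ Ck k' I f'
  else {within I, continuous f}.

Definition mxCk (k : nat) (I : set R) (p q : nat) (A : R -> 'M[R]_(p, q)) :=
  forall i j, Ck k I (fun t => A t i j).

Definition mx_deriv_on (I : set R) (p q : nat) (A A' : R -> 'M[R]_(p, q)) :=
  forall i j, has_deriv_on I (fun t => A t i j) (fun t => A' t i j).

Definition mx_cont_on (I : set R) (p q : nat) (A : R -> 'M[R]_(p, q)) :=
  forall i j, {within I, continuous (fun t => A t i j)}.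

Definition col_basis (p k : nat) (B : 'M[R]_(p, k)) (P : 'cV[R]_p -> Prop) :=
  \rank B = k /\ (forall z, P z <-> exists c : 'cV[R]_k, z = B *m c).

Definition cdim (p : nat) (P : 'cV[R]_p -> Prop) (d : nat) :=
  exists B : 'M[R]_(p, d), col_basis B P.

Definition imc (p q : nat) (A : 'M[R]_(p, q)) (z : 'cV[R]_p) :=
  exists w : 'cV[R]_q, z = A *m w.
Definition kerc (p q : nat) (A : 'M[R]_(p, q)) (z : 'cV[R]_q) := A *m z = 0.
Definition imc_perp (p q : nat) (A : 'M[R]_(p, q)) (z : 'cV[R]_p) :=
  forall w : 'cV[R]_q, z^T *m (A *m w) = 0.
Definition Sset (p : nat) (E F : 'M[R]_p) (z : 'cV[R]_p) := imc E (F *m z).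

Definition pre_regular (I : set R) (p : nat) (E F : R -> 'M[R]_p) (r th : nat) :=
  forall t, I t ->
    \rank (row_mx (E t) (F t)) = p /\ \rank (E t) = r /\
    cdim (fun z => Sset (E t) (F t) z /\ kerc (E t) z) th.

Definition msz (m0 : nat) (r : nat -> nat) (i : nat) : nat :=
  if i is j.+1 then r j else m0.

(* A run of the reduction procedure through levels 0, ..., k-1 (with all the
   choices of bases Y_i, Z_i, C_i), where r_i = rank E_i and theta_i are the
   constants of pre-regularity of {E_i, F_i}; DC i is the derivative C_i'. *)
Definition reduction_run (I : set R) (m0 : nat) (E F : R -> 'M[R]_m0) (k : nat)
  (r th : nat -> nat)
  (EE FF : forall i, R -> 'M[R]_(msz m0 r i))
  (Y : forall i, R -> 'M[R]_(msz m0 r i, r i))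
  (Z : forall i, R -> 'M[R]_(msz m0 r i, msz m0 r i - r i))
  (C DC : forall i, R -> 'M[R]_(msz m0 r i, r i)) : Prop :=
  (forall t, I t -> EE 0%N t = E t /\ FF 0%N t = F t) /\
  forall i, (i < k)%N ->
    pre_regular I (EE i) (FF i) (r i) (th i) /\
    mxCk (m0 - i) I (Y i) /\ mxCk (m0 - i) I (Z i) /\ mxCk (m0 - i) I (C i) /\
    mx_deriv_on I (C i) (DC i) /\
    forall t, I t ->
      col_basis (Y i t) (imc (EE i t)) /\
      col_basis (Z i t) (imc_perp (EE i t)) /\
      col_basis (C i t) (fun z => (Z i t)^T *m FF i t *m z = 0) /\
      EE i.+1 t = (Y i t)^T *m EE i t *m C i t /\
      FF i.+1 t = (Y i t)^T *m (FF i t *m C i t + EE i t *m DC i t).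

Fixpoint cprod (m0 : nat) (r : nat -> nat)
  (C : forall i, R -> 'M[R]_(msz m0 r i, r i)) (k : nat) (t : R)
  : 'M[R]_(m0, msz m0 r k) :=
  match k return 'M[R]_(m0, msz m0 r k) with
  | 0%N => 1%:M
  | k'.+1 => cprod C k' t *m C k' t
  end.

Definition regular (I : set R) (m0 : nat) (E F : R -> 'M[R]_m0) (mu rr : nat)
  (th : nat -> nat) : Prop :=
  (0 < mu)%N /\ (rr < m0)%N /\
  (forall i, (i.+2 < mu)%N -> (th i.+1 <= th i)%N) /\
  ((1 < mu)%N -> (0 < th (mu - 2))%N) /\
  th mu.-1 = 0%N /\
  exists (r : nat -> nat) EE FF Y Z C DC,
    r 0%N = rr /\ @reduction_run I m0 E F mu r th EE FF Y Z C DC.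

Definition Scan (I : set R) (m0 : nat) (E F : R -> 'M[R]_m0) (tb : R)
  (z : 'cV[R]_m0) : Prop :=
  exists delta : R, 0 < delta /\
    let J := [set s | I s /\ `|s - tb| < delta] in
    exists x x' : R -> 'cV[R]_m0,
      mx_deriv_on J x x' /\ mx_cont_on J x' /\
      (forall s, J s -> E s *m x' s + F s *m x s = 0) /\ x tb = z.

End DAE.

(* Main.v *)
(** A reduction step replaces [E x' + F x = 0] by [E1 u' + F1 u = 0] through
    [x = C u]: every solution lies in [S = im C], and [Y^T] is injective on
    [im E], which contains the columns of [F C + E C']. So the flow-subspace of
    the pair is the image under [C] of that of the reduced pair.  After [mu]
    steps the leading matrix is nonsingular because [theta_(mu-1) = 0], and the
    Picard iteration solves the resulting explicit linear ODE for every initial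
    value.  Since [rank E1 + theta = r], the dimensions telescope; they also give
    [mu <= m0], hence enough smoothness for each [C'] to be continuous.

    Two runs with different bases are related, at each level, by
    [E~ = K E L] and [F~ = K (F L + E L')] with [K] injective and [L] invertible
    and differentiable, so the ranks do not depend on the choices. *)
Require Import Defs.
From HB Require Import structures.
From mathcomp Require Import all_boot all_order all_algebra.
From mathcomp Require Import all_classical all_reals all_analysis.
From mathcomp Require Import ring lra.
Import Order.TTheory GRing.Theory Num.Theory.
Import numFieldNormedType.Exports.
Local Open Scope classical_set_scope.
Local Open Scope ring_scope.

Set Implicit Arguments.
Unset Strict Implicit.
Unset Printing Implicit Defensive.

(** For full column rank this is the Moore-Penrose inverse: a left inverse of [C] for which
    [C *m lpinv C] is the orthogonal projection onto the column space. The explicit formula lets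
    continuity in [t] pass from [C] to [lpinv C]. *)
HB.lock Definition lpinv (R : realType) p k (C : 'M[R]_(p, k)) : 'M[R]_(k, p) :=
  invmx (C^T *m C) *m C^T.

(** * Column bases, orthogonal projections and complements *)

Section LinearAlgebra.
Variable R : realType.

Lemma dotmx_eq0 p (w : 'cV[R]_p) : w^T *m w = 0 -> w = 0.
Proof.
move=> /matrixP /(_ 0 0); rewrite !mxE => h.
have := @psumr_eq0P R _ predT (fun i => w^T 0 i * w i 0).
have hge i : true -> 0 <= w^T 0 i * w i 0 by rewrite mxE -expr2 sqr_ge0.
move=> /(_ hge h) h0; apply/colP => i; have := h0 i isT; rewrite !mxE.
by move/eqP; rewrite -expr2 sqrf_eq0 => /eqP.
Qed.

Lemma full_colP p k (C : 'M[R]_(p, k)) :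
  \rank C = k <-> (forall v : 'cV[R]_k, C *m v = 0 -> v = 0).
Proof.
rewrite -mxrank_tr; split=> [rC v Cv|inj].
  have fC : row_free C^T by rewrite /row_free rC.
  apply: trmx_inj; apply/eqP; rewrite trmx0 -(mulmx_free_eq0 _ fC).
  by rewrite -trmx_mul Cv trmx0.
apply/eqP/inj_row_free => v vC; apply: trmx_inj; rewrite trmx0; apply: inj.
by apply: trmx_inj; rewrite trmx_mul trmxK vC trmx0.
Qed.

(** If [C^T C v = 0], then [C v] has square length [v^T C^T C v = 0], so [C v = 0] and [v = 0] by
    full column rank. *)
Lemma gram_unit p k (C : 'M[R]_(p, k)) : \rank C = k -> C^T *m C \in unitmx.
Proof.
move=> /full_colP inj; rewrite -row_free_unit -[_ *m _]trmxK /row_free mxrank_tr.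
apply/eqP/full_colP => v; rewrite trmx_mul trmxK => h; apply: inj; apply: dotmx_eq0.
by rewrite trmx_mul -!mulmxA (mulmxA C^T) h mulmx0.
Qed.

Lemma lpinvK p k (C : 'M[R]_(p, k)) : \rank C = k -> lpinv C *m C = 1%:M.
Proof. by move=> rC; rewrite lpinv.unlock -mulmxA mulVmx ?gram_unit. Qed.

Lemma tr_mul_lpinv p k (C : 'M[R]_(p, k)) :
  \rank C = k -> C^T *m (C *m lpinv C) = C^T.
Proof. by move=> rC; rewrite lpinv.unlock !mulmxA mulmxV ?gram_unit ?mul1mx. Qed.

(** Each column of [X] has the form [C c], and [lpinv C] cancels [C]. This turns membership in a
    subspace into a matrix identity. *)
Lemma col_basis_proj p k (C : 'M[R]_(p, k)) P q (X : 'M[R]_(p, q)) :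
  col_basis C P -> (forall j, P (col j X)) -> C *m lpinv C *m X = X.
Proof.
move=> [rC bC] PX; apply/matrixP => i j.
have [c ec] := (bC _).1 (PX j).
have h : C *m lpinv C *m col j X = col j X.
  by rewrite ec -!mulmxA (mulmxA (lpinv C) C) lpinvK // mul1mx.
by move/matrixP: h => /(_ i 0); rewrite {1}colE mulmxA -colE !mxE.
Qed.

Lemma perp_basis_mul0 p q (E : 'M[R]_p) (Z : 'M[R]_(p, q)) :
  col_basis Z (imc_perp E) -> Z^T *m E = 0.
Proof.
move=> [_ bZ]; apply/matrixP => i j.
have := (bZ (Z *m delta_mx i 0)).2 (ex_intro _ _ erefl) (delta_mx j 0).
rewrite trmx_mul trmx_delta -mulmxA (mulmxA Z^T) -colE -rowE.
by move=> /matrixP /(_ 0 0); rewrite !mxE.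
Qed.

(** The double complement of [im E] is [im E]. The part [n] of [v] orthogonal to [im Y] lies in
    [im Z]; if [Z^T v = 0], then [n] is orthogonal to itself and vanishes. *)
Lemma imcP_perp p k q (E : 'M[R]_p) (Y : 'M[R]_(p, k)) (Z : 'M[R]_(p, q)) :
  col_basis Y (imc E) -> col_basis Z (imc_perp E) ->
  forall v, imc E v <-> Z^T *m v = 0.
Proof.
move=> [rY bY] hZ v; have ZE := perp_basis_mul0 hZ.
move: hZ => [rZ bZ]; split=> [[w ->]|Zv].
  by rewrite mulmxA ZE mul0mx.
set n := v - Y *m (lpinv Y *m v).
have Yn : Y^T *m n = 0.
  by rewrite /n mulmxBr (mulmxA Y) mulmxA tr_mul_lpinv // subrr.
have [c nc] : exists c, n = Z *m c.
  apply/bZ => w; have [c ->] := (bY (E *m w)).1 (ex_intro _ w erefl).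
  by rewrite mulmxA -[n^T *m Y]trmxK trmx_mul trmxK Yn trmx0 mul0mx.
have [w hw] : imc E (Y *m (lpinv Y *m v)) by apply/bY; exists (lpinv Y *m v).
have ZY : Z^T *m (Y *m (lpinv Y *m v)) = 0.
  by rewrite hw mulmxA ZE mul0mx.
have n0 : n = 0.
  apply: dotmx_eq0; rewrite {1}nc trmx_mul -mulmxA /n mulmxBr Zv ZY subrr.
  by rewrite mulmx0.
by exists w; rewrite -hw; apply/eqP; rewrite -subr_eq0 -/n n0.
Qed.

End LinearAlgebra.

(** * One reduction step at a fixed time *)

Section ReductionStep.
Variable R : realType.

(** One level of [reduction_run] at a single point, with free sizes [p], [k], [q] in place of the
    dependent sizes [msz]. *)
Definition reduced_at p k q (E F : 'M[R]_p) (Y : 'M[R]_(p, k))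
    (Z : 'M[R]_(p, q)) (C DC : 'M[R]_(p, k)) (E1 F1 : 'M[R]_k) :=
  col_basis Y (imc E) /\ col_basis Z (imc_perp E) /\
  col_basis C (fun z => Z^T *m F *m z = 0) /\
  E1 = Y^T *m E *m C /\ F1 = Y^T *m (F *m C + E *m DC).

Section AtPoint.
Variables (p k q : nat) (E F : 'M[R]_p) (Y : 'M[R]_(p, k)) (Z : 'M[R]_(p, q)).
Variables (C DC : 'M[R]_(p, k)) (E1 F1 : 'M[R]_k).
Hypothesis red : reduced_at E F Y Z C DC E1 F1.

Lemma reduced_rankC : \rank C = k.
Proof. by case: red => _ [_ [[]]]. Qed.

Lemma reduced_rankY : \rank Y = k.
Proof. by case: red => [[]]. Qed.

Lemma reduced_SsetP z : Sset E F z <-> exists c : 'cV[R]_k, z = C *m c.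
Proof.
have [bY [bZ [[_ bC] _]]] := red.
by rewrite /Sset (imcP_perp bY bZ) mulmxA bC.
Qed.

Lemma reduced_mem_im n (X : 'M[R]_(p, n)) :
  (forall j, imc E (col j X)) -> Y *m lpinv Y *m X = X.
Proof. by have [bY _] := red; exact: col_basis_proj. Qed.

Lemma reduced_projE n (X : 'M[R]_(p, n)) : Y *m lpinv Y *m (E *m X) = E *m X.
Proof.
by apply: reduced_mem_im => j; exists (col j X); rewrite !colE mulmxA.
Qed.

(** The columns of [C] lie in [S], so [F] sends them into [im E], which the projection fixes. *)
Lemma reduced_projFC : Y *m lpinv Y *m (F *m C) = F *m C.
Proof.
apply: reduced_mem_im => j; rewrite colE -mulmxA -/(Sset _ _ _).
by apply/reduced_SsetP; exists (delta_mx j 0).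
Qed.

(** The transpose of [lpinv Y]: a right inverse of [Y^T] with values in [im E]. It carries the
    reduced coefficients back to the original equations. *)
Definition lift_im : 'M[R]_(p, k) := Y *m invmx (Y^T *m Y).

Lemma lift_imE : lift_im *m Y^T = Y *m lpinv Y.
Proof. by rewrite /lift_im lpinv.unlock mulmxA. Qed.

Lemma lift_im_E1 : lift_im *m E1 = E *m C.
Proof.
by have [_ [_ [_ [-> _]]]] := red; rewrite -mulmxA mulmxA lift_imE reduced_projE.
Qed.

Lemma lift_im_F1 : lift_im *m F1 = F *m C + E *m DC.
Proof.
have [_ [_ [_ [_ ->]]]] := red; rewrite mulmxA lift_imE.
by rewrite mulmxDr reduced_projE reduced_projFC.
Qed.

Lemma tr_mul_lift_im : Y^T *m lift_im = 1%:M.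
Proof. by rewrite /lift_im mulmxA mulmxV // gram_unit // reduced_rankY. Qed.

(** For [x = C u] and [x' = C u' + DC u], the residual [E x' + F x] is [lift_im] applied to the
    reduced residual, and [lift_im] is injective because [Y^T] is its left inverse. *)
Lemma reduced_eqP n (u u' : 'M[R]_(k, n)) :
  E *m (C *m u' + DC *m u) + F *m (C *m u) = 0 <-> E1 *m u' + F1 *m u = 0.
Proof.
have -> : E *m (C *m u' + DC *m u) + F *m (C *m u) =
    lift_im *m (E1 *m u' + F1 *m u).
  rewrite [RHS]mulmxDr [in RHS]mulmxA lift_im_E1 [lift_im *m _]mulmxA lift_im_F1.
  by rewrite mulmxDr mulmxDl !mulmxA -!addrA [X in _ + X]addrC.
split=> [h|->]; last by rewrite mulmx0.
by rewrite -[LHS]mul1mx -tr_mul_lift_im -mulmxA h mulmx0.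
Qed.

Lemma reduced_ker v : E1 *m v = 0 -> E *m (C *m v) = 0 :> 'cV[R]_p.
Proof. by move=> h; rewrite mulmxA -lift_im_E1 -mulmxA h mulmx0. Qed.

(** [C] maps [ker E1] isomorphically onto the intersection of [S] and [ker E], so [ker E1] has
    dimension [th], and rank-nullity applies. *)
Lemma reduced_rank th : cdim (fun z => Sset E F z /\ kerc E z) th ->
  (\rank E1 + th)%N = k.
Proof.
move=> [B [rB bB]]; have rC := reduced_rankC.
have SB j : Sset E F (col j B).
  by have [] := (bB (col j B)).2 (ex_intro _ (delta_mx j 0) (colE _ _)).
have EB : E *m B = 0.
  apply/matrixP => i j.
  have [_] := (bB (col j B)).2 (ex_intro _ (delta_mx j 0) (colE _ _)).
  by rewrite /kerc colE mulmxA -colE => /matrixP /(_ i 0); rewrite !mxE.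
have CD : C *m (lpinv C *m B) = B.
  rewrite mulmxA; apply: (@col_basis_proj _ _ _ _ (Sset E F)) => //.
  by split=> // z; exact: reduced_SsetP.
(* [D] holds the coordinates in [C] of a basis [B] of the intersection; its columns will span
   [ker E1]. *)
set D := lpinv C *m B in CD.
have rD : \rank D = th.
  apply/full_colP => v Dv; have /full_colP := rB; apply.
  by rewrite -CD -mulmxA Dv mulmx0.
have E1D : E1 *m D = 0.
  by have [_ [_ [_ [-> _]]]] := red; rewrite -!mulmxA CD EB mulmx0.
(* [kermx] is a row kernel, hence the transposes. *)
suff kerE : (D^T == kermx E1^T)%MS.
  have := eqmx_rank kerE; rewrite mxrank_tr rD mxrank_ker mxrank_tr => ->.
  by rewrite subnKC // rank_leq_row.
apply/andP; split.
  by apply/sub_kermxP; rewrite -trmx_mul E1D trmx0.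
apply/row_subP => i; set w := row _ _.
have : E1 *m w^T = 0.
  apply: trmx_inj; rewrite trmx_mul trmxK trmx0; apply/sub_kermxP.
  exact: row_sub.
move/reduced_ker => Ew.
have [c hc] : exists c, C *m w^T = B *m c.
  by apply/bB; split=> //; apply/reduced_SsetP; exists w^T.
have wD : w^T = D *m c.
  by rewrite -[LHS]mul1mx -(lpinvK rC) -mulmxA hc -CD !mulmxA lpinvK // mul1mx.
by apply/submxP; exists c^T; rewrite -trmx_mul -wD trmxK.
Qed.

End AtPoint.

(** * Reductions of two equivalent pairs *)

Section Equivalence.
Variables (p k q p' k' q' : nat).
Variables (E F : 'M[R]_p) (Y : 'M[R]_(p, k)) (Z : 'M[R]_(p, q)).
Variables (C DC : 'M[R]_(p, k)) (E1 F1 : 'M[R]_k).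
Variables (E' F' : 'M[R]_p') (Y' : 'M[R]_(p', k')) (Z' : 'M[R]_(p', q')).
Variables (C' DC' : 'M[R]_(p', k')) (E1' F1' : 'M[R]_k').
Hypothesis red : reduced_at E F Y Z C DC E1 F1.
Hypothesis red' : reduced_at E' F' Y' Z' C' DC' E1' F1'.
Variables (K : 'M[R]_(p', p)) (L DL : 'M[R]_(p, p')) (Li : 'M[R]_(p', p)).
Hypothesis Kinj : \rank K = p.
Hypothesis LLi : L *m Li = 1%:M.
Hypothesis LiL : Li *m L = 1%:M.
Hypothesis E'E : E' = K *m E *m L.
Hypothesis F'E : F' = K *m (F *m L + E *m DL).

(** After the injective [K] is cancelled, [F' z = E' w] reads [F L z = E (L w - DL z)]: the
    derivative term only shifts the preimage under [E]. *)
Lemma equiv_SsetP z : Sset E' F' z <-> Sset E F (L *m z).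
Proof.
split=> [[w]|[w hw]].
  rewrite E'E F'E -!mulmxA => /eqP; rewrite -subr_eq0 -mulmxBr => /eqP h.
  have /full_colP /(_ _ h) := Kinj.
  move/eqP; rewrite subr_eq0 mulmxDl => /eqP h1.
  exists (L *m w - DL *m z); rewrite mulmxBr -h1 -!mulmxA addrK //.
exists (Li *m (w + DL *m z)); rewrite E'E F'E -!mulmxA (mulmxA L) LLi mul1mx.
by rewrite mulmxDl -!mulmxA hw [E *m (w + _)]mulmxDr.
Qed.

(** [L] maps [S' = im C'] into [S = im C], and projecting onto [im C] changes nothing there. *)
Lemma equiv_LC : L *m C' = C *m (lpinv C *m L *m C').
Proof.
rewrite !mulmxA -mulmxA; apply/esym; apply: (@col_basis_proj _ _ _ _ (Sset E F)).
  by split; [exact: reduced_rankC red | exact: reduced_SsetP red].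
move=> j; rewrite colE -mulmxA; apply/equiv_SsetP/(reduced_SsetP red').
by exists (delta_mx j 0).
Qed.

Lemma equiv_LiC : Li *m C = C' *m (lpinv C' *m Li *m C).
Proof.
rewrite !mulmxA -mulmxA; apply/esym; apply: (@col_basis_proj _ _ _ _ (Sset E' F')).
  by split; [exact: reduced_rankC red' | exact: reduced_SsetP red'].
move=> j; rewrite colE -mulmxA; apply/equiv_SsetP; rewrite mulmxA LLi mul1mx.
by apply/(reduced_SsetP red); exists (delta_mx j 0).
Qed.

(** The matrix of [L : S' -> S] in the bases [C'] and [C]; [Mi] is that of the inverse map. [K1]
    lifts a reduced equation, scales it by [K] and reduces it again with [Y']. *)
Let M := lpinv C *m L *m C'.
Let Mi := lpinv C' *m Li *m C.
Let K1 := Y'^T *m K *m lift_im Y.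

Lemma equiv_MMi : M *m Mi = 1%:M.
Proof.
rewrite [LHS](_ : _ = lpinv C *m L *m (C' *m Mi)); last by rewrite /M -!mulmxA.
rewrite -equiv_LiC -mulmxA (mulmxA L) LLi mul1mx lpinvK //.
exact: reduced_rankC red.
Qed.

Lemma equiv_MiM : Mi *m M = 1%:M.
Proof.
rewrite [LHS](_ : _ = lpinv C' *m Li *m (C *m M)); last by rewrite /Mi -!mulmxA.
rewrite -equiv_LC -mulmxA (mulmxA Li) LiL mul1mx lpinvK //.
exact: reduced_rankC red'.
Qed.

(** The vector [K (lift_im Y v)] lies in [im E'], so it equals its projection there. If [Y'^T] kills
    it, it is zero, and the injectivity of [K] and [lift_im Y] gives [v = 0]. *)
Lemma equiv_K1 : \rank K1 = k.
Proof.
apply/full_colP => v hv.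
have rY := reduced_rankY red; have rY' := reduced_rankY red'.
have [x hx] : imc E (lift_im Y *m v).
  have [[_ bY] _] := red; apply/bY; exists (invmx (Y^T *m Y) *m v).
  by rewrite mulmxA.
have E'x : E' *m (Li *m x) = K *m (lift_im Y *m v).
  by rewrite hx E'E -!mulmxA (mulmxA L) LLi mul1mx.
have : E' *m (Li *m x) = 0.
  rewrite -(reduced_projE red') -(lift_imE Y') -mulmxA E'x !mulmxA in hv *.
  by rewrite -[RHS](mulmx0 _ (lift_im Y')) -hv /K1 !mulmxA.
rewrite E'x => h; have /full_colP /(_ _ h) hl := Kinj.
by rewrite -[v]mul1mx -(tr_mul_lift_im red) -mulmxA hl mulmx0.
Qed.

Lemma equiv_E1 : E1' = K1 *m E1 *m M.
Proof.
have [_ [_ [_ [-> _]]]] := red'.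
have -> : K1 *m E1 *m M = Y'^T *m K *m (lift_im Y *m E1) *m M.
  by rewrite /K1 !mulmxA.
have -> : Y'^T *m K *m (lift_im Y *m E1) *m M = Y'^T *m K *m E *m (C *m M).
  by rewrite (lift_im_E1 red) !mulmxA.
by rewrite -equiv_LC E'E !mulmxA.
Qed.

(** The premise is the derivative of the identity [L C' = C M]; it gathers the derivative terms of
    both sides into [E1 DM]. *)
Lemma equiv_F1 DM : L *m DC' + DL *m C' = DC *m M + C *m DM ->
  F1' = K1 *m (F1 *m M + E1 *m DM).
Proof.
move=> h; have [_ [_ [_ [_ ->]]]] := red'.
have -> : K1 *m (F1 *m M + E1 *m DM) =
    Y'^T *m K *m (lift_im Y *m F1 *m M + lift_im Y *m E1 *m DM).
  by rewrite /K1 !mulmxDr !mulmxA.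
rewrite (lift_im_F1 red) (lift_im_E1 red).
have -> : (F *m C + E *m DC) *m M + E *m C *m DM =
    F *m (C *m M) + E *m (DC *m M + C *m DM).
  by rewrite mulmxDl mulmxDr !mulmxA !addrA.
rewrite -h -equiv_LC F'E E'E !(mulmxDr, mulmxDl, mulmxA).
by rewrite -!addrA (addrC (Y'^T *m K *m E *m DL *m C')).
Qed.

Lemma equiv_rank : \rank E' = \rank E.
Proof.
have rL : row_free L by apply/row_freeP; exists Li.
rewrite E'E mxrankMfree // -mxrank_tr trmx_mul mxrankMfree ?mxrank_tr //.
by rewrite /row_free mxrank_tr Kinj.
Qed.

End Equivalence.
End ReductionStep.

(** * Limits, continuity and derivatives of matrix functions *)

Section MatrixLimits.
Variable R : realType.

(** Entrywise, like [mx_cont_on] and [mx_deriv_on], and for an arbitrary filter, so that continuity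
    and difference quotients share one calculus. *)
Definition mcvg (F : set_system R) p q (A : R -> 'M[R]_(p, q)) (B : 'M[R]_(p, q)) :=
  forall i j, (fun s => A s i j) @ F --> B i j.

Section Filter.
Context {F : set_system R} {FF : Filter F}.

Lemma mcvg_cst p q (B : 'M[R]_(p, q)) : mcvg F (fun=> B) B.
Proof. by move=> i j; exact: cvg_cst. Qed.

Lemma mcvg_near p q (A A' : R -> 'M[R]_(p, q)) B :
  (\forall s \near F, A s = A' s) -> mcvg F A B -> mcvg F A' B.
Proof.
move=> AA' cA i j; apply: cvg_trans (cA i j); apply: near_eq_cvg.
by apply: filterS AA' => s ->.
Qed.

Lemma mcvgD p q (A A' : R -> 'M[R]_(p, q)) B B' :
  mcvg F A B -> mcvg F A' B' -> mcvg F (fun s => A s + A' s) (B + B').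
Proof.
move=> cA cA' i j; rewrite mxE; under eq_fun do rewrite mxE.
exact: cvgD.
Qed.

Lemma mcvgN p q (A : R -> 'M[R]_(p, q)) B :
  mcvg F A B -> mcvg F (fun s => - A s) (- B).
Proof.
move=> cA i j; rewrite mxE; under eq_fun do rewrite mxE.
exact: cvgN.
Qed.

Lemma mcvgB p q (A A' : R -> 'M[R]_(p, q)) B B' :
  mcvg F A B -> mcvg F A' B' -> mcvg F (fun s => A s - A' s) (B - B').
Proof. by move=> cA cA'; apply: mcvgD => //; exact: mcvgN. Qed.

Lemma mcvgZ p q (f : R -> R) (A : R -> 'M[R]_(p, q)) (a : R) B :
  f @ F --> a -> mcvg F A B -> mcvg F (fun s => f s *: A s) (a *: B).
Proof.
move=> cf cA i j; rewrite mxE; under eq_fun do rewrite mxE.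
exact: cvgM.
Qed.

Lemma cvg_bigsum (T : Type) (r : seq T) (P : pred T) (f : T -> R -> R) (l : T -> R) :
  (forall i, P i -> f i @ F --> l i) ->
  (fun s => \sum_(i <- r | P i) f i s) @ F --> \sum_(i <- r | P i) l i.
Proof. by move=> h; apply: cvg_big => //; exact: add_continuous. Qed.

Lemma cvg_bigprod (T : Type) (r : seq T) (P : pred T) (f : T -> R -> R) (l : T -> R) :
  (forall i, P i -> f i @ F --> l i) ->
  (fun s => \prod_(i <- r | P i) f i s) @ F --> \prod_(i <- r | P i) l i.
Proof. by move=> h; apply: cvg_big => //; exact: mul_continuous. Qed.

Lemma mcvgM p q n (A : R -> 'M[R]_(p, q)) (A' : R -> 'M[R]_(q, n)) B B' :
  mcvg F A B -> mcvg F A' B' -> mcvg F (fun s => A s *m A' s) (B *m B').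
Proof.
move=> cA cA' i j; rewrite mxE; under eq_fun do rewrite mxE.
by apply: cvg_bigsum => k _; exact: cvgM.
Qed.

Lemma mcvg_tr p q (A : R -> 'M[R]_(p, q)) B :
  mcvg F A B -> mcvg F (fun s => (A s)^T) B^T.
Proof. by move=> cA i j; rewrite mxE; under eq_fun do rewrite mxE; exact: cA. Qed.

Lemma cvg_det p (A : R -> 'M[R]_p) B :
  mcvg F A B -> (fun s => \det (A s)) @ F --> \det B.
Proof.
move=> cA; rewrite /determinant; apply: cvg_bigsum => g _.
by apply: cvgM; [exact: cvg_cst | apply: cvg_bigprod => i _; exact: cA].
Qed.

Lemma mcvg_adj p (A : R -> 'M[R]_p) B :
  mcvg F A B -> mcvg F (fun s => \adj (A s)) (\adj B).
Proof.
move=> cA i j; rewrite mxE /cofactor; under eq_fun do rewrite mxE /cofactor.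
apply: cvgM; first exact: cvg_cst.
by apply: cvg_det => k l; rewrite !mxE; under eq_fun do rewrite !mxE; exact: cA.
Qed.

(** By Cramer's formula the inverse is the adjugate divided by the determinant, both polynomial in
    the entries. *)
Lemma mcvg_inv p (A : R -> 'M[R]_p) B :
  (\forall s \near F, A s \in unitmx) -> B \in unitmx ->
  mcvg F A B -> mcvg F (fun s => invmx (A s)) (invmx B).
Proof.
move=> uA uB cA; rewrite /invmx uB.
apply: (@mcvg_near _ _ (fun s => (\det (A s))^-1 *: \adj (A s))).
  by apply: filterS uA => s ->.
apply: mcvgZ; last exact: mcvg_adj.
by apply: cvgV; [rewrite -unitfE -unitmxE | exact: cvg_det].
Qed.

Lemma mcvg_lpinv p k (C : R -> 'M[R]_(p, k)) B :
  (\forall s \near F, \rank (C s) = k) -> \rank B = k ->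
  mcvg F C B -> mcvg F (fun s => lpinv (C s)) (lpinv B).
Proof.
move=> rC rB cC; rewrite lpinv.unlock; apply: mcvgM; last exact: mcvg_tr.
apply: mcvg_inv; [|exact: gram_unit|by apply: mcvgM => //; exact: mcvg_tr].
by apply: filterS rC => s; exact: gram_unit.
Qed.

End Filter.

Lemma mcvg_within p q (J J' : set R) (t : R) (A : R -> 'M[R]_(p, q)) B :
  J' `<=` J -> mcvg (within J (nbhs t)) A B -> mcvg (within J' (nbhs t)) A B.
Proof.
move=> JJ' cA i j; apply: cvg_trans (cA i j); apply: cvg_app.
exact: within_subset.
Qed.

Definition punctured (J : set R) (t : R) := [set s | J s /\ s != t].

Lemma mx_cont_onP (J : set R) p q (A : R -> 'M[R]_(p, q)) :
  mx_cont_on J A <-> forall t, J t -> mcvg (within J (nbhs t)) A (A t).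
Proof.
split=> [cA t Jt i j|cA i j]; first by have /subspace_continuousP := cA i j; apply.
by apply/subspace_continuousP => t Jt; exact: cA.
Qed.

Lemma mx_deriv_onP (J : set R) p q (A A' : R -> 'M[R]_(p, q)) :
  mx_deriv_on J A A' <-> forall t, J t ->
    mcvg (within (punctured J t) (nbhs t)) (fun s => (s - t)^-1 *: (A s - A t)) (A' t).
Proof.
have e i j t : (fun s => ((s - t)^-1 *: (A s - A t)) i j) =
    (fun s => (A s i j - A t i j) / (s - t)).
  by apply/funext => s; rewrite !mxE mulrC.
split=> [dA t Jt i j|dA i j t Jt]; first by rewrite e; exact: dA.
by have := dA t Jt i j; rewrite e.
Qed.

Lemma near_within (J : set R) (t : R) : \forall s \near within J (nbhs t), J s.
Proof. exact: withinT. Qed.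

Section OnSet.
Variable J : set R.

Lemma mx_cont_on_eq p q (A A' : R -> 'M[R]_(p, q)) :
  (forall t, J t -> A t = A' t) -> mx_cont_on J A -> mx_cont_on J A'.
Proof.
move=> AA' /mx_cont_onP cA; apply/mx_cont_onP => t Jt; rewrite -AA' //.
by apply: mcvg_near (cA t Jt); apply: filterS (near_within J t) => s; exact: AA'.
Qed.

Lemma mx_cont_onW (J' : set R) p q (A : R -> 'M[R]_(p, q)) :
  J' `<=` J -> mx_cont_on J A -> mx_cont_on J' A.
Proof. by move=> JJ' cA i j; apply: continuous_subspaceW (cA i j). Qed.

Lemma mx_deriv_onW (J' : set R) p q (A A' : R -> 'M[R]_(p, q)) :
  J' `<=` J -> mx_deriv_on J A A' -> mx_deriv_on J' A A'.
Proof.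
move=> JJ' /mx_deriv_onP dA; apply/mx_deriv_onP => t J't.
by apply: mcvg_within (dA t (JJ' _ J't)) => s [/JJ'].
Qed.

Lemma mx_cont_onD p q (A A' : R -> 'M[R]_(p, q)) :
  mx_cont_on J A -> mx_cont_on J A' -> mx_cont_on J (fun t => A t + A' t).
Proof.
move=> /mx_cont_onP cA /mx_cont_onP cA'; apply/mx_cont_onP => t Jt.
by apply: mcvgD; [exact: cA | exact: cA'].
Qed.

Lemma mx_cont_onN p q (A : R -> 'M[R]_(p, q)) :
  mx_cont_on J A -> mx_cont_on J (fun t => - A t).
Proof.
by move=> /mx_cont_onP cA; apply/mx_cont_onP => t Jt; apply: mcvgN; exact: cA.
Qed.

Lemma mx_cont_onM p q n (A : R -> 'M[R]_(p, q)) (A' : R -> 'M[R]_(q, n)) :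
  mx_cont_on J A -> mx_cont_on J A' -> mx_cont_on J (fun t => A t *m A' t).
Proof.
move=> /mx_cont_onP cA /mx_cont_onP cA'; apply/mx_cont_onP => t Jt.
by apply: mcvgM; [exact: cA | exact: cA'].
Qed.

Lemma mx_cont_on_tr p q (A : R -> 'M[R]_(p, q)) :
  mx_cont_on J A -> mx_cont_on J (fun t => (A t)^T).
Proof.
by move=> /mx_cont_onP cA; apply/mx_cont_onP => t Jt; apply: mcvg_tr; exact: cA.
Qed.

Lemma mx_cont_on_inv p (A : R -> 'M[R]_p) :
  (forall t, J t -> A t \in unitmx) ->
  mx_cont_on J A -> mx_cont_on J (fun t => invmx (A t)).
Proof.
move=> uA /mx_cont_onP cA; apply/mx_cont_onP => t Jt.
apply: mcvg_inv; [|exact: uA|exact: cA].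
by apply: filterS (near_within J t) => s; exact: uA.
Qed.

Lemma mx_cont_on_lpinv p k (C : R -> 'M[R]_(p, k)) :
  (forall t, J t -> \rank (C t) = k) ->
  mx_cont_on J C -> mx_cont_on J (fun t => lpinv (C t)).
Proof.
move=> rC /mx_cont_onP cC; apply/mx_cont_onP => t Jt.
apply: mcvg_lpinv; [|exact: rC|exact: cC].
by apply: filterS (near_within J t) => s; exact: rC.
Qed.

Lemma mcvg_puncturedP p q (A : R -> 'M[R]_(p, q)) (t : R) :
  mcvg (within (punctured J t) (nbhs t)) A (A t) ->
  mcvg (within J (nbhs t)) A (A t).
Proof.
move=> cA i j U nU; have h0 : \forall s \near nbhs t, punctured J t s -> U (A s i j).
  exact: cA i j U nU.
suff : \forall s \near nbhs t, J s -> U (A s i j) by [].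
apply: filterS h0 => s h Js.
have [->|st] := eqVneq s t; first exact: (@nbhs_singleton _ (A t i j)) nU.
exact: h.
Qed.

Lemma mx_deriv_on_cvg p q (A A' : R -> 'M[R]_(p, q)) (t : R) :
  mx_deriv_on J A A' -> J t -> mcvg (within J (nbhs t)) A (A t).
Proof.
move=> /mx_deriv_onP dA Jt; apply: mcvg_puncturedP.
have cst : (fun s => s - t) @ within (punctured J t) (nbhs t) --> (0 : R).
  apply: cvg_trans (_ : (fun s => s - t) @ nbhs t --> (0 : R)).
    by apply: cvg_app; exact: cvg_within.
  rewrite -(subrr t); apply: cvgB; [exact: cvg_id | exact: cvg_cst].
pose proof (mcvgD (mcvgZ cst (dA t Jt)) (@mcvg_cst _ _ _ _ (A t))) as h.
rewrite scale0r add0r in h. apply: mcvg_near h.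
apply: filterS (near_within (punctured J t) t) => s [_ st].
by rewrite scalerA mulfV ?subr_eq0 // scale1r subrK.
Qed.

Lemma mx_deriv_on_cont p q (A A' : R -> 'M[R]_(p, q)) :
  mx_deriv_on J A A' -> mx_cont_on J A.
Proof. by move=> dA; apply/mx_cont_onP => t; exact: mx_deriv_on_cvg dA. Qed.

Lemma has_deriv_on_cont (f g : R -> R) :
  has_deriv_on J f g -> {within J, continuous f}.
Proof.
(* The scalar case is read off from matrices of size 1. *)
move=> df; have ef (h : R -> R) : (fun t => ((h t)%:M : 'M[R]_1) 0 0) = h.
  by apply/funext => t; rewrite mxE mulr1n.
have dF : mx_deriv_on J (fun t => (f t)%:M : 'M[R]_1) (fun t => (g t)%:M : 'M[R]_1).
  by move=> i j; rewrite !ord1 !ef.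
by have /(_ 0 0) : mx_cont_on _ _ := mx_deriv_on_cont dF; rewrite ef.
Qed.

Lemma mx_deriv_on_eq p q (A B A' : R -> 'M[R]_(p, q)) :
  (forall t, J t -> A t = B t) -> mx_deriv_on J A A' -> mx_deriv_on J B A'.
Proof.
move=> AB /mx_deriv_onP dA; apply/mx_deriv_onP => t Jt.
apply: mcvg_near (dA t Jt); apply: filterS (near_within (punctured J t) t).
by move=> s [Js _]; rewrite !AB.
Qed.

Lemma mx_deriv_on_eqr p q (A A' B' : R -> 'M[R]_(p, q)) :
  (forall t, J t -> A' t = B' t) -> mx_deriv_on J A A' -> mx_deriv_on J A B'.
Proof.
move=> AB /mx_deriv_onP dA; apply/mx_deriv_onP => t Jt; rewrite -AB //.
exact: dA.
Qed.

Lemma mx_deriv_onD p q (A A' B B' : R -> 'M[R]_(p, q)) :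
  mx_deriv_on J A A' -> mx_deriv_on J B B' ->
  mx_deriv_on J (fun t => A t + B t) (fun t => A' t + B' t).
Proof.
move=> /mx_deriv_onP dA /mx_deriv_onP dB; apply/mx_deriv_onP => t Jt.
apply: mcvg_near (mcvgD (dA t Jt) (dB t Jt)); apply: nearW => s.
by rewrite -scalerDr opprD addrACA.
Qed.

Lemma mx_deriv_onN p q (A A' : R -> 'M[R]_(p, q)) :
  mx_deriv_on J A A' -> mx_deriv_on J (fun t => - A t) (fun t => - A' t).
Proof.
move=> /mx_deriv_onP dA; apply/mx_deriv_onP => t Jt.
apply: mcvg_near (mcvgN (dA t Jt)); apply: nearW => s.
by rewrite -scalerN opprD.
Qed.

Lemma mx_deriv_on_cst p q (A : 'M[R]_(p, q)) : mx_deriv_on J (fun=> A) (fun=> 0).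
Proof.
apply/mx_deriv_onP => t Jt; apply: mcvg_near (@mcvg_cst _ _ _ _ 0).
by apply: nearW => s; rewrite subrr scaler0.
Qed.

Lemma mx_deriv_onM p q n (A A' : R -> 'M[R]_(p, q)) (B B' : R -> 'M[R]_(q, n)) :
  mx_deriv_on J A A' -> mx_deriv_on J B B' ->
  mx_deriv_on J (fun t => A t *m B t) (fun t => A t *m B' t + A' t *m B t).
Proof.
move=> dA dB; apply/mx_deriv_onP => t Jt.
have cB : mcvg (within (punctured J t) (nbhs t)) B (B t).
  by apply: mcvg_within (mx_deriv_on_cvg dB Jt) => s [].
have /mx_deriv_onP /(_ t Jt) dA' := dA; have /mx_deriv_onP /(_ t Jt) dB' := dB.
(* The increment is split as [A(t) (B(s) - B(t)) + (A(s) - A(t)) B(s)], which requires continuity of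
   [B] alone. *)
pose proof (mcvgD (mcvgM (@mcvg_cst _ _ _ _ (A t)) dB') (mcvgM dA' cB)) as h.
apply: mcvg_near h; apply: nearW => s.
rewrite -scalemxAr -scalemxAl -scalerDr mulmxBr mulmxBl; congr (_ *: _).
by rewrite addrC addrA subrK.
Qed.

(* Only continuity of a left inverse of [C] is needed:
   (x(s) - x(t)) / (s - t) = C(s) (u(s) - u(t)) / (s - t) + (C(s) - C(t)) / (s - t) u(t). *)
Lemma mx_deriv_on_solve p k n (C DC : R -> 'M[R]_(p, k)) (u : R -> 'M[R]_(k, n))
    (x x' : R -> 'M[R]_(p, n)) :
  (forall t, J t -> \rank (C t) = k) ->
  (forall t, J t -> C t *m u t = x t) ->
  mx_deriv_on J C DC -> mx_deriv_on J x x' ->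
  mx_deriv_on J u (fun t => lpinv (C t) *m (x' t - DC t *m u t)).
Proof.
move=> rC Cu dC dx; apply/mx_deriv_onP => t Jt.
have cG : mcvg (within (punctured J t) (nbhs t)) (fun s => lpinv (C s)) (lpinv (C t)).
  have cC := mx_deriv_on_cont dC.
  have /mx_cont_onP /(_ t Jt) := mx_cont_on_lpinv rC cC.
  by apply: mcvg_within => s [].
have /mx_deriv_onP /(_ t Jt) dC' := dC; have /mx_deriv_onP /(_ t Jt) dx' := dx.
pose proof (mcvgM cG (mcvgB dx' (mcvgM dC' (@mcvg_cst _ _ _ _ (u t))))) as h.
apply: mcvg_near h.
apply: filterS (near_within (punctured J t) t) => s [Js st].
rewrite -scalemxAl -scalerBr -scalemxAr -!Cu //; congr (_ *: _).
rewrite mulmxBl opprB addrA subrK -mulmxBr mulmxA lpinvK ?mul1mx //.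
exact: rC.
Qed.

Hypothesis Jlim : forall t, J t -> ProperFilter (within (punctured J t) (nbhs t)).

(** Every point of [J] is an accumulation point, so the punctured filter is proper and its limits
    are unique. *)
Lemma mx_deriv_on_unique p q (A A' B' : R -> 'M[R]_(p, q)) :
  mx_deriv_on J A A' -> mx_deriv_on J A B' -> forall t, J t -> A' t = B' t.
Proof.
move=> dA dB t Jt; apply/matrixP => i j; have PF := Jlim Jt.
by apply: (cvg_unique (@Rhausdorff R) (dA i j t Jt) (dB i j t Jt)).
Qed.

End OnSet.
End MatrixLimits.

(** * Antiderivatives, mean value bounds and dyadic series *)

Section Antiderivative.
Variable R : realType.

Lemma is_derive_has_deriv_on (J : set R) (f g : R -> R) :
  (forall t, J t -> is_derive t 1 f (g t)) -> has_deriv_on J f g.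
Proof.
move=> df t Jt; have [ft <-] := df t Jt.
have shift_t : (fun s => s - t) @ within [set s | J s /\ s != t] (nbhs t) --> 0^'.
  move=> U; rewrite /dnbhs /within /= => nU.
  have : (fun s => s - t) @ nbhs t --> (0 : R).
    by rewrite -(subrr t); apply: cvgB; [exact: cvg_id | exact: cvg_cst].
  move=> /(_ _ nU) h0.
  have h : \forall s \near nbhs t, s - t != 0 -> U (s - t) by exact: h0.
  suff : \forall s \near nbhs t, J s /\ s != t -> U (s - t) by [].
  by apply: filterS h => s hs [_ st]; apply: hs; rewrite subr_eq0.
have := cvg_comp _ _ shift_t ft; apply: cvg_trans; apply: near_eq_cvg.
apply: nearW => s /=.
by rewrite /shift /= [_ *: 1]mulr1 subrK /GRing.scale /= mulrC.
Qed.

(** At an interior point, all small increments stay in [J], so the relative derivative is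
    two-sided. *)
Lemma has_deriv_on_is_derive (J : set R) (f g : R -> R) t :
  has_deriv_on J f g -> J° t -> is_derive t 1 f (g t).
Proof.
move=> df Jt; have Jt' : J t by exact: interior_subset Jt.
have shift_t : (fun h => h + t) @ (0 : R)^' --> within [set s | J s /\ s != t] (nbhs t).
  move=> U nU.
  have {}nU : \forall s \near nbhs t, J s /\ s != t -> U s by [].
  have c0 : (fun h => h + t) @ nbhs (0 : R) --> t.
    rewrite -[X in _ --> X](add0r t).
    by apply: cvgD; [exact: cvg_id | exact: cvg_cst].
  have h : \forall h \near nbhs (0 : R),
      (J (h + t) /\ h + t != t -> U (h + t)) /\ J (h + t).
    exact: c0 _ (filterI nU Jt).
  suff : \forall h \near nbhs (0 : R), h != 0 -> U (h + t) by [].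
  apply: filterS h => e [h1 h2] e0; apply: h1; split=> //.
  by rewrite -subr_eq0 addrK.
have cv : (fun h => h^-1 *: ((f \o shift t) (h *: (1 : R)) - f t)) @ (0 : R)^' --> g t.
  have := cvg_comp _ _ shift_t (df t Jt'); apply: cvg_trans; apply: near_eq_cvg.
  apply: nearW => s /=.
  by rewrite /shift /= [_ *: 1]mulr1 addrK /GRing.scale /= mulrC.
split; first by apply/cvg_ex; exists (g t).
exact: cvg_lim cv.
Qed.

(** The retraction of the line onto [[a, b]]; composing with it extends a function constantly beyond
    both endpoints. *)
Definition clamp (a b t : R) := Num.max a (Num.min t b).

Lemma clamp_itv a b t : a <= b -> a <= clamp a b t <= b.
Proof. by move=> ab; rewrite /clamp le_max lexx /= ge_max ab ge_min lexx orbT. Qed.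

Lemma clamp_id a b t : a <= t <= b -> clamp a b t = t.
Proof. by move=> /andP[at_ tb]; rewrite /clamp (min_idPl tb) (max_idPr at_). Qed.

Lemma clamp_continuous a b : continuous (clamp a b).
Proof.
move=> t.
have cmin : {for t, continuous ((id : R -> R^o) \min (fun=> b))}.
  by apply: continuous_min; [exact: cvg_id | exact: cvg_cst].
have ca : {for t, continuous ((fun=> a) : R -> R^o)} by exact: cvg_cst.
exact: continuous_max ca cmin.
Qed.

Lemma has_antiderivative (a b : R) (g : R -> R) : a <= b ->
  {within [set s | a <= s <= b], continuous g} ->
  exists G, has_deriv_on [set s | a <= s <= b] G g.
Proof.
move=> ab /subspace_continuousP cg; pose h := g \o clamp a b.
have ch : continuous h.
  move=> t; apply: (@cvg_comp _ _ _ (clamp a b) g _ _ _ _ (cg _ _)); last first.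
    exact: clamp_itv.
  move=> U nU; have {}nU : \forall s \near nbhs (clamp a b t), a <= s <= b -> U s by [].
  have {}nU : \forall s \near nbhs t, a <= clamp a b s <= b -> U (clamp a b s).
    exact: clamp_continuous nU.
  suff : \forall s \near nbhs t, U (clamp a b s) by [].
  by apply: filterS nU => s; apply; exact: clamp_itv.
(* Starting at [a - 1], with integrability up to [b + 1], makes every point of [[a, b]] interior, so
   the fundamental theorem also covers the endpoints. *)
pose G x := (\int[lebesgue_measure]_(t in `[a - 1, x]) h t)%R.
exists G; apply: is_derive_has_deriv_on => t /= atb.
have [tu at1] : t < b + 1 /\ a - 1 < t.
  move: atb => /andP[at_ tb]; split; first by rewrite ltr_pwDr.
  by rewrite ltrBlDr ltr_pwDr.
have hi : lebesgue_measure.-integrable `[a - 1, b + 1] (EFin \o h).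
  apply: continuous_compact_integrable; first exact: segment_compact.
  exact: continuous_subspaceT.
have [dG eG] := @continuous_FTC1_closed R h (a - 1) t (b + 1) tu hi at1 (ch t).
by split; [exact: dG | rewrite -derive1E eG /h /= clamp_id].
Qed.

(** The mean value theorem between [tb] and [t], whose distance is at most [b - a]. *)
Lemma has_deriv_on_bound (a b tb M : R) (f g : R -> R) :
  has_deriv_on [set s | a <= s <= b] f g -> f tb = 0 -> a <= tb <= b ->
  (forall t, a <= t <= b -> `|g t| <= M) ->
  forall t, a <= t <= b -> `|f t| <= M * (b - a).
Proof.
move=> df f0 atb gM.
have cf := has_deriv_on_cont df.
have mvt x y : a <= x -> x <= y -> y <= b -> `|f y - f x| <= M * (b - a).
  move=> ax xy yb.
  have sub : `[x, y] `<=` [set s | a <= s <= b].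
    by move=> s /=; rewrite in_itv /= => /andP[xs sy]; rewrite (le_trans ax) ?(le_trans sy).
  have [|c cxy ->] := @MVT_segment R f g x y xy _ (continuous_subspaceW sub cf).
    move=> z; rewrite in_itv /= => /andP[xz zy].
    apply: (has_deriv_on_is_derive df).
    have : `]x, y[%classic z by rewrite /= in_itv /= xz zy.
    move=> oz; apply: (@filterS _ _ _ `]x, y[%classic); last first.
      by apply: open_nbhs_nbhs; split; [exact: interval_open | exact: oz].
    apply: subset_trans sub; exact: subset_itv_oo_cc.
  rewrite normrM ler_pM //; first by apply: gM; exact: sub cxy.
  by rewrite ger0_norm ?subr_ge0 // lerB.
move=> t /andP[at_ tb1]; case/andP: atb => atb tbb.
have [h|/ltW h] := leP tb t; have := mvt _ _ _ h; rewrite f0 ?subr0 ?sub0r ?normrN;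
  by apply.
Qed.

Lemma dyadic_cvg0 (B : R) : (fun n => 2 * B / 2 ^+ n) @ \oo --> (0 : R).
Proof.
have := @cvg_geometric R (2 * B) (2^-1); rewrite ger0_norm // invf_lt1 // ltr1n => /(_ isT).
by apply: cvg_trans; apply: near_eq_cvg; apply: nearW => n /=; rewrite exprVn.
Qed.

(* The dyadic rate is the contraction factor of the Picard iteration. *)
Lemma dyadic_series_limit (u : nat -> R) (B : R) :
  (forall n, `|u n| <= B / 2 ^+ n) ->
  exists l, forall n, `|l - \sum_(k < n) u k| <= 2 * B / 2 ^+ n.
Proof.
move=> uB; pose S n := \sum_(k < n) u k.
(* The geometric tail is kept exact, so that the induction on [m] closes. *)
have tail n m : `|S (n + m)%N - S n| <= 2 * B / 2 ^+ n - 2 * B / 2 ^+ (n + m).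
  elim: m => [|m IH]; first by rewrite addn0 !subrr normr0.
  rewrite addnS {1}/S big_ord_recr /= -/(S (n + m)%N) addrAC.
  apply: le_trans (ler_normD _ _) _; apply: le_trans (lerD IH (uB _)) _.
  rewrite exprS invfM; set x := (2 ^+ n)^-1; set y := (2 ^+ (n + m))^-1.
  by rewrite le_eqVlt; apply/orP; left; apply/eqP; field.
have B0 : 0 <= B by have := le_trans (normr_ge0 _) (uB 0%N); rewrite expr0 divr1.
have tail' n m : (n <= m)%N -> `|S m - S n| <= 2 * B / 2 ^+ n.
  move=> nm; rewrite -(subnKC nm); apply: le_trans (tail _ _) _.
  by rewrite gerBl divr_ge0 ?exprn_ge0 // mulr_ge0.
have to0 := @dyadic_cvg0 B.
have cS : cvgn S.
  apply/cauchy_cvgP/cauchy_ballP => e e0.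
  have /cvgrPdist_lt /(_ (e / 2)) := to0; rewrite divr_gt0 // => /(_ isT) [N _ hN].
  exists (S @` [set n | (N <= n)%N], S @` [set n | (N <= n)%N]).
    split; exists N => //= n Nn; by exists n.
  move=> [x y] /= [[n Nn <-] [m Nm <-]]; rewrite /ball /=.
  have hN' := hN N (leqnn N); rewrite sub0r normrN ger0_norm in hN'; last first.
    by rewrite divr_ge0 ?exprn_ge0 // mulr_ge0.
  rewrite -(subrKA (S N)); apply: le_lt_trans (ler_normD _ _) _.
  rewrite [e]splitr; apply: ltrD; first exact: le_lt_trans (tail' _ _ Nn) _.
  by rewrite distrC; exact: le_lt_trans (tail' _ _ Nm) _.
exists (limn S) => n.
have c : (fun m => `|S m - S n|) @ \oo --> `|limn S - S n|.
  by apply: cvg_norm; apply: cvgB; [exact: cS | exact: cvg_cst].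
rewrite -(cvg_lim _ c) //; apply: limr_le; first by apply/cvg_ex; eexists; exact: c.
by exists n => // m /= nm; exact: tail'.
Qed.

End Antiderivative.

(** * Picard iteration on a short segment *)

Section LinearODE.
Variable R : realType.

Section Segment.
Variables (a b tb : R) (d : nat).
Hypothesis atb : a <= tb <= b.
Local Notation S := [set s : R | a <= s <= b].

Lemma has_mx_antiderivative (g : R -> 'cV[R]_d) : mx_cont_on S g ->
  exists P : R -> 'cV[R]_d, mx_deriv_on S P g /\ P tb = 0.
Proof.
move=> cg; have ab : a <= b by case/andP: atb => /le_trans; apply.
have /choice [G hG] i : exists G, has_deriv_on S G (fun t => g t i 0).
  by apply: has_antiderivative => //; exact: cg.
pose P t : 'cV[R]_d := \col_i G i t.
have dP : mx_deriv_on S P g.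
  move=> i j; rewrite ord1.
  have -> : (fun t => P t i 0) = G i by apply/funext => t; rewrite mxE.
  exact: hG.
exists (fun t => P t + - P tb); split; last by rewrite subrr.
apply: mx_deriv_on_eqr (mx_deriv_onD dP (@mx_deriv_on_cst _ _ _ _ _)).
by move=> t _; rewrite addr0.
Qed.

Lemma mx_deriv_on_bound (f g : R -> 'cV[R]_d) (M : R) :
  mx_deriv_on S f g -> f tb = 0 ->
  (forall t, S t -> forall i, `|g t i 0| <= M) ->
  forall t, S t -> forall i, `|f t i 0| <= M * (b - a).
Proof.
move=> df f0 gM t St i.
apply: (has_deriv_on_bound (df i 0) _ atb) => //; first by rewrite f0 mxE.
by move=> s Ss; exact: gM.
Qed.

Variables (A : R -> 'M[R]_d) (M : R).
Hypothesis cA : mx_cont_on S A.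
Hypothesis AM : forall t, S t -> forall i j, `|A t i j| <= M.
Hypothesis contr : d%:R * M * (b - a) <= 2^-1.

Lemma mulmx_bound (x : 'cV[R]_d) (t B : R) : S t ->
  (forall i, `|x i 0| <= B) -> forall i, `|(A t *m x) i 0| <= d%:R * M * B.
Proof.
move=> St xB i; rewrite mxE; apply: le_trans (ler_norm_sum _ _ _) _.
apply: le_trans (_ : \sum_(j < d) M * B <= _).
  by apply: ler_sum => j _; rewrite normrM ler_pM //; exact: AM.
by rewrite sumr_const card_ord -[X in X <= _]mulr_natl mulrA.
Qed.

(** The operator sending [v] to the integral of [A v] from [tb] at least halves sup bounds, by
    [contr]. The solution is the sum of its iterates on the constant [c]. *)
Lemma linear_ode_segment (c : 'cV[R]_d) :
  exists x : R -> 'cV[R]_d, mx_deriv_on S x (fun t => A t *m x t) /\ x tb = c.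
Proof.
have Stb : S tb by exact: atb.
(* A total integration operator; for discontinuous [g] its value is the dummy 0. *)
have /choice [P hP] (g : R -> 'cV[R]_d) : exists P : R -> 'cV[R]_d,
    mx_cont_on S g -> mx_deriv_on S P g /\ P tb = 0.
  have [/has_mx_antiderivative [P hP]|ng] := pselect (mx_cont_on S g).
    by exists P.
  by exists (fun=> 0).
pose v := fix v n : R -> 'cV[R]_d :=
  if n is n'.+1 then P (fun t => A t *m v n' t) else fun=> c.
have cv n : mx_cont_on S (v n).
  elim: n => [|n IH] /=.
    exact: mx_deriv_on_cont (@mx_deriv_on_cst _ _ _ _ _).
  by have [dv _] := hP _ (mx_cont_onM cA IH); exact: mx_deriv_on_cont dv.
have dv n : mx_deriv_on S (v n.+1) (fun t => A t *m v n t) /\ v n.+1 tb = 0.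
  exact: hP _ (mx_cont_onM cA (cv n)).
(* [B] bounds every entry of the initial iterate [c]. *)
pose B := \sum_i `|c i 0|.
have B0 : 0 <= B by apply: sumr_ge0.
have contrB e : 0 <= e -> d%:R * M * e * (b - a) <= e / 2.
  by move=> e0; rewrite mulrAC mulrC ler_wpM2l.
have vB n t : S t -> forall i, `|v n t i 0| <= B / 2 ^+ n.
  elim: n t => [|n IH] t St i /=.
    by rewrite expr0 divr1 /B (bigD1 i) //= lerDl sumr_ge0.
  have [dvn v0] := dv n.
  have bd := mx_deriv_on_bound dvn v0 (fun s Ss => mulmx_bound Ss (IH s Ss)).
  apply: le_trans (bd t St i) _; apply: le_trans (contrB _ _) _.
    by rewrite divr_ge0 // exprn_ge0.
  by rewrite exprSr invfM mulrA.
(* The partial sums satisfy [X_(n+1)' = A X_n] and [X_(n+1)(tb) = c]. *)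
pose X n t : 'cV[R]_d := \sum_(k < n) v k t.
have dX n : mx_deriv_on S (X n.+1) (fun t => A t *m X n t).
  elim: n => [|n IH].
    apply: (mx_deriv_on_eq (A := fun=> c)).
      by move=> t _; rewrite /X big_ord1.
    apply: mx_deriv_on_eqr (@mx_deriv_on_cst _ _ _ _ _).
    by move=> t _; rewrite /X big_ord0 mulmx0.
  apply: (mx_deriv_on_eq (A := fun t => X n.+1 t + v n.+1 t)).
    by move=> t _; rewrite [RHS]/X big_ord_recr.
  apply: mx_deriv_on_eqr (mx_deriv_onD IH (dv n).1).
  by move=> t _; rewrite [in RHS]/X big_ord_recr /= mulmxDr.
have X0 n : X n.+1 tb = c.
  elim: n => [|n IH]; first by rewrite /X big_ord1.
  have -> : X n.+2 tb = X n.+1 tb + v n.+1 tb by rewrite /X big_ord_recr.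
  by rewrite IH (dv n).2 addr0.
have /choice [x hx] t : exists x : 'cV[R]_d, S t ->
    forall n i, `|(x - X n t) i 0| <= 2 * B / 2 ^+ n.
  have [St|nSt] := pselect (S t); last by exists 0.
  have /choice [l hl] i := dyadic_series_limit (fun n => vB n t St i).
  exists (\col_i l i) => _ n i; rewrite !mxE.
  have -> : X n t i 0 = \sum_(k < n) v k t i 0 by rewrite /X summxE.
  exact: hl.
have to0 : (fun n => 2 * B / 2 ^+ n) @ \oo --> (0 : R).
  exact: dyadic_cvg0.
(* A uniform limit of continuous functions, by the three-epsilon argument. *)
have cx : mx_cont_on S x.
  apply/mx_cont_onP => t St i j; rewrite ord1; apply/cvgrPdist_lt => e e0.
  have /cvgrPdist_lt /(_ (e / 3)) := to0; rewrite divr_gt0 // => /(_ isT) [N _ hN].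
  have {}hN : 2 * B / 2 ^+ N < e / 3.
    have := hN N (leqnn N); rewrite /= sub0r normrN ger0_norm //.
    by rewrite divr_ge0 ?exprn_ge0 // mulr_ge0.
  have cX : mx_cont_on S (X N.+1) by exact: mx_deriv_on_cont (dX N).
  have /mx_cont_onP /(_ t St i 0) /cvgrPdist_lt /(_ (e / 3)) := cX.
  rewrite divr_gt0 // => /(_ isT) nX.
  near=> s.
  have Ss : S s by near: s; exact: withinT.
  have hX : `|X N.+1 t i 0 - X N.+1 s i 0| < e / 3 by near: s.
  have small r (Sr : S r) : `|x r i 0 - X N.+1 r i 0| < e / 3.
    have := hx r Sr N.+1 i; rewrite !mxE => h; apply: le_lt_trans h _.
    apply: le_lt_trans hN; rewrite ler_wpM2l ?mulr_ge0 //.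
    by rewrite lef_pV2 ?posrE ?exprn_gt0 // exprS ler_peMl ?exprn_ge0 // ler1n.
  have -> : x t i 0 - x s i 0 = (x t i 0 - X N.+1 t i 0)
    + (X N.+1 t i 0 - X N.+1 s i 0) - (x s i 0 - X N.+1 s i 0) by ring.
  have -> : e = e / 3 + e / 3 + e / 3 by field.
  apply: le_lt_trans (ler_normB _ _) _; rewrite ltrD ?small //.
  by apply: le_lt_trans (ler_normD _ _) _; rewrite ltrD ?small.
have [dW W0] := hP _ (mx_cont_onM cA cx).
set W := P _ in dW W0.
have xW t : S t -> x t = W t + c.
  move=> St; apply/colP => i; apply/eqP; rewrite -subr_eq0 -normr_eq0 eq_le normr_ge0 andbT.
  (* [W + c - X_(n+1)] vanishes at [tb] and has derivative [A (x - X_n)]. It and [x - X_(n+1)] are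
     each at most [B / 2^n], so [x] agrees with the differentiable function [W + c]. *)
  have close n : `|x t i 0 - (W t + c) i 0| <= 2 * B / 2 ^+ n.
    have dD := mx_deriv_onD (mx_deriv_onD dW (@mx_deriv_on_cst _ _ _ _ c))
                            (mx_deriv_onN (dX n)).
    have D0 : W tb + c - X n.+1 tb = 0 by rewrite W0 X0 add0r subrr.
    have bd := mx_deriv_on_bound dD D0.
    have /bd /(_ t St i) {bd} : forall s, S s -> forall i,
        `|(A s *m x s + 0 - A s *m X n s) i 0| <= d%:R * M * (2 * B / 2 ^+ n).
      move=> s Ss k; rewrite addr0 -mulmxBr; apply: mulmx_bound => // k'.
      exact: hx.
    have e0 : 0 <= 2 * B / 2 ^+ n by rewrite divr_ge0 ?exprn_ge0 // mulr_ge0.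
    move=> /le_trans /(_ (contrB _ e0)) h1.
    have h2 := hx t St n.+1 i; move: h1 h2.
    rewrite exprS invfM mxE [(x t - _) i 0]mxE [(- X n.+1 t) i 0]mxE.
    set w := (W t + c) i 0; set y := X _ _ _ _; set z := x t i 0.
    set q := (2 ^+ n)^-1 => h1 h2.
    have -> : z - w = (z - y) - (w - y) by ring.
    apply: le_trans (ler_normB _ _) _; apply: le_trans (lerD h2 h1) _.
    by rewrite le_eqVlt; apply/orP; left; apply/eqP; field.
  have := @ler_cvg_to _ _ _ _ _ _ _ _ (@cvg_cst _ _ _ _ _) to0; apply.
  by apply: nearW => n; exact: close.
exists (fun t => W t + c); split; last by rewrite W0 add0r.
apply: mx_deriv_on_eqr (mx_deriv_onD dW (@mx_deriv_on_cst _ _ _ _ c)).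
by move=> t St; rewrite addr0 xW.
Unshelve. all: by end_near.
Qed.

End Segment.
End LinearODE.

(** * Nondegenerate intervals and local solutions of linear equations *)

Section Intervals.
Variables (R : realType) (I : set R).
Hypothesis ndI : nd_interval I.

(** The domain of the local solutions in [Scan]. *)
Definition trace_ball (t0 delta : R) := [set s | I s /\ `|s - t0| < delta].

Lemma nd_interval_limit (t eta : R) : I t -> 0 < eta ->
  exists s, [/\ I s, s != t & `|s - t| < eta].
Proof.
move=> It e0; have [[a [b [Ia [Ib ab]]]] conv] := ndI.
have [c Ic ct] : exists2 c, I c & c != t.
  by have [at_|?] := eqVneq a t; [exists b => //; rewrite -at_ gt_eqF | exists a].
have d0 : 0 < `|c - t| by rewrite normr_gt0 subr_eq0.
(* The point [t + k (c - t)] stays between [t] and [c] because [k <= 1], and within [eta / 2] of [t]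
   by the second bound. *)
pose k := Num.min 1 (eta / (2 * `|c - t|)).
have k0 : 0 < k by rewrite lt_min ltr01 divr_gt0 // mulr_gt0.
have k1 : k <= 1 by rewrite ge_min lexx.
exists (t + k * (c - t)); split.
- have [tc|tc] := leP t c.
    apply: (conv t _ c) => //; first by rewrite lerDl mulr_ge0 ?subr_ge0 // ltW.
    by rewrite -lerBrDl ler_piMl // subr_ge0.
  apply: (conv c _ t) => //; last by rewrite gerDl pmulr_rle0 // subr_le0 ltW.
  by rewrite -lerBlDl ler_niMl // subr_le0 ltW.
- by rewrite -subr_eq0 addrC addKr mulf_neq0 ?subr_eq0 // gt_eqF.
- rewrite addrC addKr normrM (gtr0_norm k0).
  apply: le_lt_trans (_ : eta / 2 < _); last by rewrite gtr_pMr // invf_lt1 // ltr1n.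
  apply: le_trans (_ : eta / (2 * `|c - t|) * `|c - t| <= _).
    by rewrite ler_wpM2r // ge_min lexx orbT.
  by rewrite invfM mulrA divfK ?gt_eqF.
Qed.

Lemma punctured_proper (J : set R) t :
  (forall eta, 0 < eta -> exists s, [/\ J s, s != t & `|s - t| < eta]) ->
  ProperFilter (within (punctured J t) (nbhs t)).
Proof.
move=> lim; split; last exact: within_filter.
move=> h0; have {h0} h0 : \forall s \near nbhs t, punctured J t s -> False by [].
have /nbhs_ballP [e /= e0 he] := h0.
have [s [Js st se]] := lim e e0.
by apply: (he s) => //; rewrite /ball /= distrC.
Qed.

Lemma nd_interval_proper t : I t -> ProperFilter (within (punctured I t) (nbhs t)).
Proof. by move=> It; apply: punctured_proper => eta; exact: nd_interval_limit. Qed.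

Lemma trace_ball_proper t0 delta t : trace_ball t0 delta t ->
  ProperFilter (within (punctured (trace_ball t0 delta) t) (nbhs t)).
Proof.
move=> [It td]; apply: punctured_proper => eta e0.
have [|s [Is st]] := @nd_interval_limit t (Num.min eta (delta - `|t - t0|)) It.
  by rewrite lt_min e0 subr_gt0.
rewrite lt_min => /andP[se sd]; exists s; split=> //; split=> //.
rewrite -(subrKA t); apply: le_lt_trans (ler_normD _ _) _.
by rewrite -ltrBrDr.
Qed.

(** If [t] is the last point of [I], then [b = t]; otherwise [b] lies strictly to the right. With
    [left_end] this yields a compact segment that covers a relative neighbourhood of [t], endpoints
    of [I] included. *)
Lemma right_end (t eta : R) : I t -> 0 < eta -> exists b delta : R,
  [/\ I b, t <= b <= t + eta, 0 < delta & forall s, I s -> s < t + delta -> s <= b].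
Proof.
move=> It e0; have [_ conv] := ndI.
have [[c [Ic tc]]|no] := pselect (exists c, I c /\ t < c).
  exists (Num.min c (t + eta)), (Num.min c (t + eta) - t).
  have tm : t < Num.min c (t + eta) by rewrite lt_min tc ltrDl.
  split; last by move=> s _; rewrite addrC subrK => /ltW.
  - by apply: (conv t _ c) => //; [exact: ltW | rewrite ge_min lexx].
  - by rewrite (ltW tm) ge_min lexx orbT.
  - by rewrite subr_gt0.
exists t, 1; split=> //; first by rewrite lexx lerDl ltW.
by move=> s Is _; rewrite leNgt; apply/negP => ts; apply: no; exists s.
Qed.

Lemma left_end (t eta : R) : I t -> 0 < eta -> exists a delta : R,
  [/\ I a, t - eta <= a <= t, 0 < delta & forall s, I s -> t - delta < s -> a <= s].
Proof.
move=> It e0; have [_ conv] := ndI.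
have [[c [Ic tc]]|no] := pselect (exists c, I c /\ c < t).
  exists (Num.max c (t - eta)), (t - Num.max c (t - eta)).
  have tm : Num.max c (t - eta) < t by rewrite gt_max tc gtrBl.
  split; last by move=> s _; rewrite opprB addrC subrK => /ltW.
  - by apply: (conv c _ t) => //; [rewrite le_max lexx | exact: ltW].
  - by rewrite (ltW tm) le_max lexx orbT.
  - by rewrite subr_gt0.
exists t, 1; split=> //; first by rewrite lexx gerBl ltW.
by move=> s Is _; rewrite leNgt; apply/negP => ts; apply: no; exists s.
Qed.

Lemma linear_ode_local d (A : R -> 'M[R]_d) (c : 'cV[R]_d) tb :
  mx_cont_on I A -> I tb -> exists delta : R, 0 < delta /\
  exists x : R -> 'cV[R]_d,
    mx_deriv_on (trace_ball tb delta) x (fun t => A t *m x t) /\ x tb = c.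
Proof.
move=> cA Itb; have [_ conv] := ndI.
(* A continuous function dominating all entries of [A]; it yields a common bound [M] near [tb]. *)
pose f (s : R) : R := \sum_i \sum_j `|A s i j|.
have cf : f s @[s --> within I (nbhs tb)] --> f tb.
  apply: cvg_bigsum => i _; apply: cvg_bigsum => j _; apply: cvg_norm.
  by have /mx_cont_onP := cA; apply.
pose M : R := f tb + 1.
have f0 s : 0 <= f s by apply: sumr_ge0 => i _; apply: sumr_ge0.
have M0 : 0 < M by rewrite ltr_wpDl.
have Af s i j : `|A s i j| <= f s.
  rewrite /f (bigD1 i) //= (bigD1 j) //= -addrA lerDl addr_ge0 //.
    exact: sumr_ge0.
  by apply: sumr_ge0 => k _; apply: sumr_ge0.
have [e /= e0 eM] : exists2 e : R, 0 < e &
    forall s, `|tb - s| < e -> I s -> forall i j, `|A s i j| <= M.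
  have /cvgrPdist_lt /(_ 1 ltr01) h := cf.
  have {}h : \forall s \near nbhs tb, I s -> `|f tb - f s| < 1 by exact: h.
  have /nbhs_ballP [e /= e0 he] := h; exists e => // s se Is i j.
  apply: le_trans (Af s i j) _; have := he s se Is.
  by rewrite distrC /M ltr_norml => /andP[_ /ltW]; rewrite lerBlDl.
(* The first bound keeps the segment where [M] is valid; the second gives [d M (b - a) <= 1/2], as
   [b - a <= 2 eta]. The summand 1 keeps the divisor positive when [d = 0]. *)
pose eta : R := Num.min (e / 2) (4 * (d%:R * M + 1))^-1.
have dM : 0 <= d%:R * M by rewrite mulr_ge0 // ltW.
have eta0 : 0 < eta.
  by rewrite lt_min divr_gt0 //= invr_gt0 mulr_gt0 // ltr_wpDl.
have [b [db [Ib /andP[tbb bt] db0 hb]]] := right_end Itb eta0.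
have [a [da [Ia /andP[ta atb] da0 ha]]] := left_end Itb eta0.
have SI s : a <= s <= b -> I s by move=> /andP[? ?]; exact: (conv a s b).
have etae : eta < e.
  by apply: le_lt_trans (_ : e / 2 < e); [rewrite ge_min lexx | rewrite gtr_pMr // invf_lt1 // ltr1n].
have AM s : a <= s <= b -> forall i j, `|A s i j| <= M.
  move=> Ss; apply: eM; last exact: SI.
  case/andP: Ss => as_ sb; apply: le_lt_trans etae.
  by rewrite ler_norml; apply/andP; split; lra.
have contr : d%:R * M * (b - a) <= 2^-1.
  apply: le_trans (_ : (d%:R * M + 1) * (2 * (4 * (d%:R * M + 1))^-1) <= _).
    rewrite ler_pM ?subr_ge0 ?lerDl //; first exact: le_trans tbb.
    have : eta <= (4 * (d%:R * M + 1))^-1 by rewrite ge_min lexx orbT.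
    by lra.
  have : d%:R * M + 1 != 0 by rewrite gt_eqF // ltr_wpDl.
  by move=> h; rewrite le_eqVlt; apply/orP; left; apply/eqP; field.
have cA' : mx_cont_on [set s | a <= s <= b] A by apply: mx_cont_onW cA.
have tbab : a <= tb <= b by rewrite atb tbb.
have [x [dx x0]] := linear_ode_segment tbab cA' AM contr c.
exists (Num.min da db); split; first by rewrite lt_min da0 db0.
exists x; split=> //; apply: mx_deriv_onW dx => s [Is]; rewrite lt_min /=.
rewrite !ltr_norml => /andP[/andP[h1 _] /andP[_ h2]].
by rewrite ha ?hb //; lra.
Qed.

End Intervals.

(** * The flow-subspace under reduction *)

Section FlowSubspace.
Variables (R : realType) (I : set R).
Hypothesis ndI : nd_interval I.

Lemma Ck_cont k f : Ck k I f -> {within I, continuous f}.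
Proof. by case: k => [//|k] [f' [df _]]; exact: has_deriv_on_cont df. Qed.

Lemma mxCk_cont k p q (A : R -> 'M[R]_(p, q)) : mxCk k I A -> mx_cont_on I A.
Proof. by move=> cA i j; exact: Ck_cont (cA i j). Qed.

(** The class of [A] supplies some continuous derivative, and uniqueness on a nondegenerate interval
    identifies [DA] with it. *)
Lemma mxCk_deriv_cont k p q (A DA : R -> 'M[R]_(p, q)) : (0 < k)%N ->
  mxCk k I A -> mx_deriv_on I A DA -> mx_cont_on I DA.
Proof.
case: k => // k _ cA dA.
have /choice [f hf] (ij : 'I_p * 'I_q) : exists f : R -> R,
    has_deriv_on I (fun t => A t ij.1 ij.2) f /\ {within I, continuous f}.
  by have [f [df /Ck_cont cf]] := cA ij.1 ij.2; exists f.
pose B t : 'M[R]_(p, q) := \matrix_(i, j) f (i, j) t.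
have eB i j : (fun t => B t i j) = f (i, j) by apply/funext => t; rewrite mxE.
have dB : mx_deriv_on I A B by move=> i j; rewrite eB; exact: (hf (i, j)).1.
apply: (mx_cont_on_eq (A := B)); last by move=> i j; rewrite eB; exact: (hf (i, j)).2.
by move=> t It; apply: (mx_deriv_on_unique _ dB dA) => //; exact: nd_interval_proper.
Qed.

Lemma Scan_eq p (E F E' F' : R -> 'M[R]_p) t z :
  (forall s, I s -> E s = E' s /\ F s = F' s) ->
  Scan I E F t z -> Scan I E' F' t z.
Proof.
move=> eq [delta [d0 [x [x' [dx [cx' [ex xt]]]]]]].
exists delta; split=> //; exists x, x'; split=> //; split=> //; split=> // s Js.
by have [<- <-] := eq s Js.1; exact: ex.
Qed.

(** The equation becomes [x' = - E^-1 F x] with continuous coefficients, solvable locally for every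
    initial value. *)
Lemma Scan_nonsingular p (E F : R -> 'M[R]_p) t z :
  mx_cont_on I E -> mx_cont_on I F -> (forall s, I s -> E s \in unitmx) ->
  I t -> Scan I E F t z.
Proof.
move=> cE cF uE It.
have cA : mx_cont_on I (fun s => - (invmx (E s) *m F s)).
  by apply: mx_cont_onN; apply: mx_cont_onM cF; exact: mx_cont_on_inv.
have [delta [d0 [x [dx xt]]]] := linear_ode_local ndI z cA It.
exists delta; split=> //; exists x, (fun s => - (invmx (E s) *m F s) *m x s).
split; first exact: dx.
have JI : trace_ball I t delta `<=` I by move=> s [].
split; first by apply: mx_cont_onM (mx_deriv_on_cont dx); exact: mx_cont_onW cA.
split=> // s [Is _].
by rewrite mulNmx mulmxN !mulmxA mulmxV ?uE // mul1mx addNr.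
Qed.

Lemma Scan_reduce p k q (E F : R -> 'M[R]_p) (Y : R -> 'M[R]_(p, k))
    (Z : R -> 'M[R]_(p, q)) (C DC : R -> 'M[R]_(p, k)) (E1 F1 : R -> 'M[R]_k) t z :
  (forall s, I s -> reduced_at (E s) (F s) (Y s) (Z s) (C s) (DC s) (E1 s) (F1 s)) ->
  mx_deriv_on I C DC -> mx_cont_on I DC -> I t ->
  Scan I E F t z <-> exists w, z = C t *m w /\ Scan I E1 F1 t w.
Proof.
move=> red dC cDC It; have cC := mx_deriv_on_cont dC.
have rC s : I s -> \rank (C s) = k by move=> /red; exact: reduced_rankC.
split=> [[delta [d0 [x [x' [dx [cx' [ex xt]]]]]]]|].
  set J := [set s | _] in dx cx' ex.
  have JI : J `<=` I by move=> s [].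
  have Jt : J t by split=> //; rewrite subrr normr0.
  pose u s := lpinv (C s) *m x s.
  have Cu s : J s -> C s *m u s = x s.
    move=> Js; rewrite /u mulmxA; have r := red s (JI s Js).
    apply: (@col_basis_proj _ _ _ _ (Sset (E s) (F s))).
      by split; [exact: reduced_rankC r | exact: reduced_SsetP r].
    move=> j; rewrite ord1.
    have -> : col 0 (x s) = x s by apply/colP => i; rewrite mxE.
    (* The equation gives [F x = E (- x')], so [x] lies in [S = im C]. *)
    by exists (- x' s); apply/eqP; rewrite mulmxN -addr_eq0 addrC ex.
  have rCJ s : J s -> \rank (C s) = k by move=> /JI; exact: rC.
  have dCJ := mx_deriv_onW JI dC.
  have du := mx_deriv_on_solve rCJ Cu dCJ dx.
  set u' := (fun s => _) in du.
  have cG : mx_cont_on J (fun s => lpinv (C s)).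
    by apply: mx_cont_on_lpinv rCJ _; exact: mx_cont_onW cC.
  have cu : mx_cont_on J u := mx_deriv_on_cont du.
  have cu' : mx_cont_on J u'.
    apply: mx_cont_onM cG _; apply: mx_cont_onD cx' _; apply: mx_cont_onN.
    by apply: mx_cont_onM _ cu; exact: mx_cont_onW cDC.
  (* Both sides are derivatives of [x = C u] on [J]. *)
  have x'E s : J s -> x' s = C s *m u' s + DC s *m u s.
    have dCu := mx_deriv_on_eq Cu (mx_deriv_onM dCJ du).
    by apply: mx_deriv_on_unique dx dCu s => r; exact: trace_ball_proper.
  exists (u t); split; first by rewrite Cu.
  exists delta; split=> //; exists u, u'; split=> //; split=> //; split=> // s Js.
  apply/(reduced_eqP (red s (JI s Js))).
  by rewrite -x'E // Cu // ex.
move=> [w [-> [delta [d0 [u [u' [du [cu' [eu ut]]]]]]]]].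
exists delta; split=> //.
set J := [set s | _] in du cu' eu *.
have JI : J `<=` I by move=> s [].
exists (fun s => C s *m u s), (fun s => C s *m u' s + DC s *m u s).
split; first exact: mx_deriv_onM (mx_deriv_onW JI dC) du.
split; last first.
  by split=> [s Js|]; [apply/(reduced_eqP (red s (JI s Js))); exact: eu | rewrite ut].
apply: mx_cont_onD; apply: mx_cont_onM => //.
- exact: mx_cont_onW cC.
- exact: mx_cont_onW cDC.
- exact: mx_deriv_on_cont du.
Qed.

(** * Ranks, continuity and flow-subspaces along a run *)

Section Run.
Variables (m0 : nat) (E F : R -> 'M[R]_m0) (mu : nat) (r th : nat -> nat).
Variables (EE FF : forall i, R -> 'M[R]_(msz m0 r i)).
Variable (Y : forall i, R -> 'M[R]_(msz m0 r i, r i)).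
Variable (Z : forall i, R -> 'M[R]_(msz m0 r i, msz m0 r i - r i)).
Variables (C DC : forall i, R -> 'M[R]_(msz m0 r i, r i)).
Hypothesis run : reduction_run I E F mu th EE FF Y Z C DC.

Lemma run_reduced i t : (i < mu)%N -> I t ->
  reduced_at (EE i t) (FF i t) (Y i t) (Z i t) (C i t) (DC i t)
    (EE i.+1 t : 'M[R]_(r i)) (FF i.+1 t : 'M[R]_(r i)).
Proof. by move=> imu It; have [_ /(_ i imu) [_ [_ [_ [_ [_ /(_ t It)]]]]]] := run. Qed.

Lemma run_deriv i : (i < mu)%N -> mx_deriv_on I (C i) (DC i).
Proof. by move=> imu; have [_ /(_ i imu) [_ [_ [_ [_ []]]]]] := run. Qed.

Lemma run_rank i t : (i < mu)%N -> I t -> \rank (EE i t) = r i.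
Proof.
by move=> imu It; have [_ /(_ i imu) [/(_ t It) [_ []]]] := run.
Qed.

(** This includes [i = mu - 1], hence the rank of the final leading matrix [EE mu], a level at which
    pre-regularity is not part of the run. *)
Lemma run_rank_next i t : (i < mu)%N -> I t -> (\rank (EE i.+1 t) + th i)%N = r i.
Proof.
move=> imu It; have red := run_reduced imu It.
have [_ /(_ i imu) [/(_ t It) [_ [_ cd]] _]] := run.
exact: reduced_rank red _ cd.
Qed.

Lemma run_rank_sum i t : (i < mu)%N -> I t ->
  (r i + \sum_(j < i) th j)%N = r 0%N.
Proof.
move=> imu It; elim: i imu => [|i IH] imu; first by rewrite big_ord0 addn0.
rewrite big_ord_recr /= addnCA -(IH (ltnW imu)) addnC; congr addn.
by rewrite -(run_rank_next (ltnW imu) It) (run_rank imu It).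
Qed.

Hypothesis mum0 : (mu <= m0)%N.

(** As [i < mu <= m0], the smoothness order [m0 - i] of [C i] is at least 1. *)
Lemma run_DC_cont i : (i < mu)%N -> mx_cont_on I (DC i).
Proof.
move=> imu; have [_ /(_ i imu) [_ [_ [_ [cC [dC _]]]]]] := run.
apply: mxCk_deriv_cont cC dC.
by rewrite subn_gt0 (leq_trans imu).
Qed.

Lemma run_cont i : mx_cont_on I E -> mx_cont_on I F -> (i <= mu)%N ->
  mx_cont_on I (EE i) /\ mx_cont_on I (FF i).
Proof.
move=> cE cF; elim: i => [|i IH] imu.
  by split; [apply: mx_cont_on_eq cE | apply: mx_cont_on_eq cF] => t It;
     have [/(_ t It) [h1 h2] _] := run; rewrite ?h1 ?h2.
have [cEi cFi] := IH (ltnW imu).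
have [_ /(_ i imu) [_ [/mxCk_cont cY [_ [/mxCk_cont cC [_ eqs]]]]]] := run.
have cDC := run_DC_cont imu.
have cYt := mx_cont_on_tr cY.
split.
  apply: mx_cont_on_eq (mx_cont_onM (mx_cont_onM cYt cEi) cC) => t It.
  by have [_ [_ [_ [-> _]]]] := eqs t It.
apply: mx_cont_on_eq (mx_cont_onM cYt
  (mx_cont_onD (mx_cont_onM cFi cC) (mx_cont_onM cEi cDC))) => t It.
by have [_ [_ [_ [_ ->]]]] := eqs t It.
Qed.

Lemma run_Scan i t z : I t -> (i <= mu)%N ->
  Scan I E F t z <-> exists w, z = cprod C i t *m w /\ Scan I (EE i) (FF i) t w.
Proof.
move=> It; elim: i z => [|i IH] z imu.
  have eqE s : I s -> EE 0%N s = E s /\ FF 0%N s = F s by case: run => h _ /h.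
  split=> [sz|[w [-> sw]]].
    exists z; split; first by rewrite /= mul1mx.
    by apply: Scan_eq sz => s /eqE [-> ->].
  by rewrite /= mul1mx; apply: Scan_eq sw => s /eqE [-> ->].
have step w := Scan_reduce w (fun s => run_reduced imu (t := s))
  (run_deriv imu) (run_DC_cont imu) It.
rewrite (IH _ (ltnW imu)); split=> [[w [-> /step [v [-> sv]]]]|[v [-> sv]]].
  by exists v; rewrite /= mulmxA.
exists (C i t *m v); split; first by rewrite /= mulmxA.
by apply/step; exists v.
Qed.

Lemma run_cprod_rank i t : I t -> (i <= mu)%N -> \rank (cprod C i t) = msz m0 r i.
Proof.
move=> It; elim: i => [|i IH] imu; first exact: mxrank1.
apply/full_colP => v /=; rewrite -mulmxA => h.
have /full_colP /(_ _ h) hC := IH (ltnW imu).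
by have /full_colP := reduced_rankC (run_reduced imu It); apply.
Qed.

(** At level [mu] the flow-subspace is the whole space, and [cprod C mu] maps it injectively onto
    that of the original pair. *)
Lemma run_col_basis t : mx_cont_on I E -> mx_cont_on I F ->
  (forall s, I s -> \rank (EE mu s) = msz m0 r mu) ->
  I t -> col_basis (cprod C mu t) (Scan I E F t).
Proof.
move=> cE cF full It; split; first exact: run_cprod_rank.
move=> z; rewrite (run_Scan z It (leqnn mu)); split=> [[w [-> _]]|[w ->]].
  by exists w.
exists w; split=> //; have [cEmu cFmu] := run_cont cE cF (leqnn mu).
apply: Scan_nonsingular => // s Is.
by rewrite -row_free_unit /row_free full.
Qed.

End Run.

(** * Independence of the choice of bases *)

Section TwoRuns.
Variables (m0 : nat) (E F : R -> 'M[R]_m0) (mu : nat).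
Variables (r th : nat -> nat) (EE FF : forall i, R -> 'M[R]_(msz m0 r i)).
Variable (Y : forall i, R -> 'M[R]_(msz m0 r i, r i)).
Variable (Z : forall i, R -> 'M[R]_(msz m0 r i, msz m0 r i - r i)).
Variables (C DC : forall i, R -> 'M[R]_(msz m0 r i, r i)).
Variables (r' th' : nat -> nat) (EE' FF' : forall i, R -> 'M[R]_(msz m0 r' i)).
Variable (Y' : forall i, R -> 'M[R]_(msz m0 r' i, r' i)).
Variable (Z' : forall i, R -> 'M[R]_(msz m0 r' i, msz m0 r' i - r' i)).
Variables (C' DC' : forall i, R -> 'M[R]_(msz m0 r' i, r' i)).
Hypothesis run : reduction_run I E F mu th EE FF Y Z C DC.
Hypothesis run' : reduction_run I E F mu th' EE' FF' Y' Z' C' DC'.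

(* The two runs differ by a change of unknowns x = L x' and a scaling K of the
   equations; [L] is rectangular because the sizes agree only propositionally. *)
Lemma run_equivalent i : (i <= mu)%N ->
  exists (K : R -> 'M[R]_(msz m0 r' i, msz m0 r i))
    (L DL : R -> 'M[R]_(msz m0 r i, msz m0 r' i))
    (Li : R -> 'M[R]_(msz m0 r' i, msz m0 r i)),
  mx_deriv_on I L DL /\ forall t, I t ->
    [/\ \rank (K t) = msz m0 r i, L t *m Li t = 1%:M, Li t *m L t = 1%:M,
        EE' i t = K t *m EE i t *m L t &
        FF' i t = K t *m (FF i t *m L t + EE i t *m DL t)].
Proof.
elim: i => [|i IH] imu.
  exists (fun=> 1%:M), (fun=> 1%:M), (fun=> 0), (fun=> 1%:M).
  split; first exact: mx_deriv_on_cst.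
  move=> t It; rewrite !mulmx1 mulmx0 addr0 !mul1mx; split=> //.
  - exact: mxrank1.
  - by case: run run' => h _ [h' _]; rewrite (h t It).1 (h' t It).1.
  - by case: run run' => h _ [h' _]; rewrite (h t It).2 (h' t It).2.
have [K [L [DL [Li [dL eqv]]]]] := IH (ltnW imu).
pose M t := lpinv (C i t) *m L t *m C' i t.
have rC t : I t -> \rank (C i t) = r i by move=> /(run_reduced run imu) /reduced_rankC.
have CM t : I t -> C i t *m M t = L t *m C' i t.
  move=> It; have [hK hL hL' hE hF] := eqv t It.
  exact/esym/(equiv_LC (run_reduced run imu It) (run_reduced run' imu It) hK hL hE hF).
have dLC := mx_deriv_onM dL (run_deriv run' imu).
(* [M] is differentiable because it solves [C M = L C'], whose right side is. *)
have dM := mx_deriv_on_solve rC CM (run_deriv run imu) dLC.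
set DM := (fun t => _) in dM.
(* The two product rules for [L C' = C M] agree by uniqueness of derivatives. *)
have prodE t : I t -> L t *m DC' i t + DL t *m C' i t = DC i t *m M t + C i t *m DM t.
  move=> It; rewrite [RHS]addrC.
  have d := mx_deriv_on_eq CM (mx_deriv_onM (run_deriv run imu) dM).
  by apply: (mx_deriv_on_unique _ dLC d It) => s; exact: nd_interval_proper.
exists (fun t => (Y' i t)^T *m K t *m lift_im (Y i t)), M, DM,
  (fun t => lpinv (C' i t) *m Li t *m C i t).
split=> // t It; have [hK hL hL' hE hF] := eqv t It.
have red := run_reduced run imu It; have red' := run_reduced run' imu It.
split.
- exact (equiv_K1 red red' hK hL hE).
- exact (equiv_MMi red red' hK hL hE hF).
- exact (equiv_MiM red red' hK hL hL' hE hF).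
- exact (equiv_E1 red red' hK hL hE hF).
- exact (equiv_F1 red red' hK hL hE hF (prodE t It)).
Qed.

Lemma run_rank_equal i t : (i <= mu)%N -> I t -> \rank (EE' i t) = \rank (EE i t).
Proof.
move=> imu It; have [K [L [DL [Li [_ /(_ t It) [hK hL _ hE _]]]]]] := run_equivalent imu.
exact: equiv_rank hK hL hE.
Qed.

End TwoRuns.
End FlowSubspace.

(** * Restriction to a subset *)

Section Restriction.
Variables (R : realType) (I J : set R).
Hypothesis JI : J `<=` I.

Lemma has_deriv_onW (f f' : R -> R) : has_deriv_on I f f' -> has_deriv_on J f f'.
Proof.
move=> df t Jt; apply: cvg_trans (df t (JI Jt)); apply: cvg_app.
by apply: within_subset => s [/JI].
Qed.

Lemma CkW k f : Ck k I f -> Ck k J f.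
Proof.
elim: k f => [|k IH] f /=; first exact: continuous_subspaceW.
by move=> [f' [/has_deriv_onW df /IH cf]]; exists f'.
Qed.

Lemma reduction_runW m0 (E F : R -> 'M[R]_m0) k r th EE FF Y Z C DC :
  @reduction_run R I m0 E F k r th EE FF Y Z C DC ->
  @reduction_run R J m0 E F k r th EE FF Y Z C DC.
Proof.
move=> [h0 h]; split=> [t /JI|i ik]; first exact: h0.
have [pr [cY [cZ [cC [dC eqs]]]]] := h i ik.
split; first by move=> t /JI; exact: pr.
split; first by move=> a b; apply: CkW; exact: cY.
split; first by move=> a b; apply: CkW; exact: cZ.
split; first by move=> a b; apply: CkW; exact: cC.
split; first exact: mx_deriv_onW dC.
by move=> t /JI; exact: eqs.
Qed.

End Restriction.

(** Monotonicity carries positivity of the last value to all [mu - 1] values, each of which is then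
    at least 1. This bounds the index by the size of the pair. *)
Lemma characteristic_sum_ge (mu : nat) (th : nat -> nat) :
  (forall i, (i.+2 < mu)%N -> (th i.+1 <= th i)%N) ->
  ((1 < mu)%N -> (0 < th (mu - 2))%N) ->
  (mu.-1 <= \sum_(i < mu.-1) th i)%N.
Proof.
case: mu => [|[|mu]] // mono /(_ isT); rewrite subn2 /= => last0.
(* The induction descends from the last positive value, whose index is now [mu]. *)
have pos k : (k <= mu)%N -> (0 < th (mu - k))%N.
  elim: k => [|k IH] kmu; first by rewrite subn0.
  apply: leq_trans (IH (ltnW kmu)) _; have := mono (mu - k.+1)%N.
  by rewrite -subSn // subSS; apply; rewrite !ltnS leq_subr.
apply: leq_trans (_ : \sum_(i < mu.+1) 1 <= _)%N.
  by rewrite sum_nat_const card_ord muln1.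
apply: leq_sum => i _; have imu : (i <= mu)%N by rewrite -ltnS.
by have := pos (mu - i)%N (leq_subr _ _); rewrite subKn.
Qed.

Theorem theoremt (R : realType) (I : set R) (m0 : nat) (E F : R -> 'M[R]_m0)
  (mu rr : nat) (th : nat -> nat) :
  nd_interval I -> mxCk m0 I E -> mxCk m0 I F ->
  regular I E F mu rr th ->
  (* (1) *)
  ((forall t, I t -> cdim (Scan I E F t) (rr - \sum_(i < mu.-1) th i)%N) /\
   (forall (r th' : nat -> nat) EE FF Y Z C DC,
      @reduction_run R I m0 E F mu r th' EE FF Y Z C DC ->
      r mu.-1 = (rr - \sum_(i < mu.-1) th i)%N /\
      forall t, I t -> col_basis (cprod C mu t) (Scan I E F t))) /\
  (* (2) *)
  (forall Isub : set R, nd_interval Isub -> Isub `<=` I ->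
     regular Isub E F mu rr th).
Proof.
move=> ndI /mxCk_cont cE /mxCk_cont cF reg.
have [mu0 [rrm0 [mono [last0 [th0 [r [EE [FF [Y [Z [C [DC [r0 run]]]]]]]]]]]]] := reg.
have [[t0 [_ [It0 _]]] _] := ndI.
case: mu => [//|mu] in reg mu0 mono last0 th0 run *.
have rsum := run_rank_sum run (ltnSn mu) It0; rewrite r0 in rsum.
have sum_ge := characteristic_sum_ge mono last0; rewrite /= in sum_ge th0 *.
(* With index [mu.+1], the chain is [mu <= sum of th <= rr < m0]. *)
have mum0 : (mu < m0)%N.
  apply: leq_ltn_trans rrm0; apply: leq_trans sum_ge _.
  by rewrite -rsum leq_addl.
have main (r' th' : nat -> nat) EE' FF' Y' Z' C' DC' :
    @reduction_run R I m0 E F mu.+1 r' th' EE' FF' Y' Z' C' DC' ->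
    r' mu = (rr - \sum_(i < mu) th i)%N /\
    forall t, I t -> col_basis (cprod C' mu.+1 t) (Scan I E F t).
  move=> run'.
  (* Both numbers are ranks of level-[mu] leading matrices, which do not depend on the run. *)
  have r'r : r' mu = r mu.
    rewrite -(run_rank run' (ltnSn mu) It0) -(run_rank run (ltnSn mu) It0).
    exact: (run_rank_equal ndI run run' (leqnSn mu) It0).
  split; first by rewrite r'r -rsum addnK.
  (* The product includes the last factor [C' mu], which has [r' mu] columns. The final leading
     matrix has full rank [r mu] since [th mu = 0]. *)
  move=> t It; apply: (run_col_basis ndI run') => // s Is.
  rewrite (run_rank_equal ndI run run' (leqnn _) Is) /= r'r.
  by have := run_rank_next run (ltnSn mu) Is; rewrite th0 addn0.
split; last first.
  (* The bases of the given run, restricted to [J], serve again. *)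
  move=> J ndJ JI; split=> //; split=> //; split=> //; split=> //; split=> //.
  exists r, EE, FF, Y, Z, C, DC; split=> //; exact: reduction_runW run.
split; last exact: main.
move=> t It; have [<- /(_ t It) basis] := main _ _ _ _ _ _ _ _ run.
by exists (cprod C mu.+1 t).
Qed.
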